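(* Let $\Bbbk$ be an infinite field, $\mathcal{P}=\Bbbk[x_1,\dots,x_n]$, and let $\mathcal{I}\lhd\mathcal{P}$ be a (proper) homogeneous ideal of dimension $D$ with $\mathcal{R}=\mathcal{P}/\mathcal{I}$. Let $a_{ij}$ ($1\le i\le D$, $1\le j\le n-D$) be $D(n-D)$ undetermined parameters (algebraically independent over $\Bbbk$), let $\tilde{\mathcal{P}}=\Bbbk(a_{ij})[x_1,\dots,x_{n-D}]$, and let $\tilde{\mathcal{I}}\unlhd\tilde{\mathcal{P}}$ be the ideal generated by the polynomials obtained from the elements of a Gröbner basis $G$ of $\mathcal{I}$ by substituting $-\sum_{j=1}^{n-D}a_{ij}x_j$ for $x_{n-D+i}$ for every $1\le i\le D$. Then the following algorithm correctly determines the absolute reduction number $r(\mathcal{R})$: compute a Pommaret basis $\mathcal{H}$ of $\tilde{\mathcal{I}}$ and return $\deg\mathcal{H}-1$. That is, $\tilde{\mathcal{I}}$ has a (finite) Pommaret basis, and for any Pommaret basis $\mathcal{H}$ of $\tilde{\mathcal{I}}$ $$r(\mathcal{R})=\deg\mathcal{H}-1.$$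
   Context: The dimension of $\mathcal{I}$ is $D=\dim\mathcal{I}$, the Krull dimension of $\mathcal{P}/\mathcal{I}$. All leading terms and Gröbner bases are with respect to the degree reverse lexicographic order with $x_n\prec\cdots\prec x_1$ on $\mathcal{P}$, respectively $x_{n-D}\prec\cdots\prec x_1$ on $\tilde{\mathcal{P}}$. Reduction numbers: let $y_1,\dots,y_D\in\mathcal{P}_1$ be $D$ linear forms defining a Noether normalisation of $\mathcal{R}$, i.e. $\Bbbk[y_1,\dots,y_D]\to\mathcal{R}$ is injective (with the $y_i$ algebraically independent) and $\mathcal{R}$ is a finite module over it; equivalently, $\mathcal{I}+\langle y_1,\dots,y_D\rangle$ is a zero-dimensional ideal. Then $\mathcal{J}=\mathcal{I}+\langle y_1,\dots,y_D\rangle$ is called a minimal reduction of $\mathcal{I}$, and $r_{\mathcal{J}}(\mathcal{R})$ is the largest degree $q$ with $(\mathcal{P}/\mathcal{J})_q\neq0$. The (absolute) reduction number $r(\mathcal{R})$ is the minimum of $r_{\mathcal{J}}(\mathcal{R})$ over all minimal reductions $\mathcal{J}$ of $\mathcal{I}$. Pommaret bases: let $K$ be a field and $S=K[x_1,\dots,x_m]$. For a term (power product) $t\in S$ let $w(t)$ be the largest index $k$ with $x_k\mid t$ (for $t=1$ all variables are used in the cone below). A Pommaret basis of a monomial ideal $\mathcal{L}\unlhd S$ is a finite set $H$ of terms in $\mathcal{L}$ such that $\mathcal{L}=\bigoplus_{h\in H}K[x_{w(h)},\dots,x_m]\cdot h$ as $K$-vector spaces. A Pommaret basis of a homogeneous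 polynomial ideal $\mathcal{K}\unlhd S$ is a finite set $\mathcal{H}\subset\mathcal{K}$ of homogeneous polynomials with pairwise distinct leading terms such that the set $\{\operatorname{lt}h\mid h\in\mathcal{H}\}$ is a Pommaret basis of the leading ideal $\operatorname{lt}\mathcal{K}$. $\deg\mathcal{H}$ denotes the maximal degree of an element of $\mathcal{H}$. *)

(* Defs.v *)
(* Indices are 0-based: the variable x_(i+1) of the mathematics is 'X_i.       *)
From HB Require Import structures.
From mathcomp Require Import all_boot all_order all_algebra.
From mathcomp Require Import mpoly.
Set Implicit Arguments.
Unset Strict Implicit.
Unset Printing Implicit Defensive.
Import GRing.Theory.
Local Open Scope ring_scope.

Definition infinite_type (T : eqType) : Prop :=
  forall s : seq T, exists x : T, x \notin s.

(* Ideals are Prop-valued, unlike those of ring_quotient: membership in a      *)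
(* generated ideal is not given by a boolean predicate.                        *)
Section Ideals.
Variable R : comNzRingType.

Definition is_ideal (I : R -> Prop) : Prop :=
  [/\ I 0, (forall u v, I u -> I v -> I (u + v)) &
      forall a u, I u -> I (a * u)].

Definition is_proper (I : R -> Prop) : Prop := ~ I 1.

Definition is_prime (Q : R -> Prop) : Prop :=
  [/\ is_ideal Q, is_proper Q & forall u v, Q (u * v) -> Q u \/ Q v].

Definition ideal_gen (S : R -> Prop) (p : R) : Prop :=
  exists s : seq (R * R),
    (forall u, u \in s -> S u.2) /\ p = \sum_(u <- s) u.1 * u.2.

(* A strictly increasing chain Q 0 < ... < Q l of prime ideals of R above I,   *)
(* that is, a chain of l + 1 prime ideals of R / I.                            *)
Definition prime_chain (I : R -> Prop) (l : nat) (Q : nat -> R -> Prop) :=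
  [/\ forall i, (i <= l)%N -> is_prime (Q i),
      forall p, I p -> Q 0%N p &
      forall i, (i < l)%N ->
        (forall p, Q i p -> Q i.+1 p) /\ (exists p, Q i.+1 p /\ ~ Q i p)].

Definition krull_dim (I : R -> Prop) (d : nat) : Prop :=
  (exists Q, prime_chain I d Q) /\
  (forall l, (exists Q, prime_chain I l Q) -> (l <= d)%N).

End Ideals.

Section Polynomials.
Variables (n : nat) (k : fieldType).
Implicit Types (I K : {mpoly k[n]} -> Prop) (p q : {mpoly k[n]}).

Definition homogeneous_ideal I : Prop :=
  is_ideal I /\ forall p d, I p -> I (pihomog mdeg d p).

(* The order built in multinomials (and hence mlead) is degree lexicographic,  *)
(* so the degree reverse lexicographic one is defined here: in equal degrees,  *)
(* m1 < m2 iff m1 has the larger exponent at the last index where they differ. *)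
Definition drl_lt (m1 m2 : 'X_{1..n}) : bool :=
  (mdeg m1 < mdeg m2)%N ||
  (mdeg m1 == mdeg m2) &&
    [exists i : 'I_n, (m2 i < m1 i)%N &&
       [forall j : 'I_n, (i < j)%N ==> (m1 j == m2 j)]].

(* Since 0 is the least exponent, this is the largest element of msupp p;      *)
(* it has the junk value 0 when p = 0.                                         *)
Definition lm p : 'X_{1..n} :=
  \big[(fun m1 m2 => if drl_lt m1 m2 then m2 else m1)/0%MM]_(m <- msupp p) m.

Definition lead_ideal (S : {mpoly k[n]} -> Prop) : {mpoly k[n]} -> Prop :=
  ideal_gen (fun t => exists p, [/\ S p, p != 0 & t = 'X_[lm p]]).

Definition groebner_basis (G : seq {mpoly k[n]}) I : Prop :=
  (forall g, g \in G -> I g) /\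
  (forall p, lead_ideal (fun g => g \in G) p <-> lead_ideal I p).

(* The largest index of a variable dividing 'X_[t]; it is 0 for t = 0, so that *)
(* the cone of the term 1 is the whole polynomial ring.                        *)
Definition mclass (t : 'X_{1..n}) : nat := (\max_(i < n | 0 < t i) i)%N.

(* The subspace k[x_w, x_(w+1), ...] t, with w the class of t.                 *)
Definition cone (t : 'X_{1..n}) p : Prop :=
  exists q, p = q * 'X_[t] /\
    forall m, m \in msupp q -> forall i : 'I_n, (0 < m i)%N -> (mclass t <= i)%N.

(* The last two clauses say that L is the direct sum of the cones of H.        *)
Definition pommaret_monomial (H : seq 'X_{1..n}) (L : {mpoly k[n]} -> Prop) :=
  [/\ uniq H,
      forall h, h \in H -> L 'X_[h],
      forall p, L p <->
        exists c : 'X_{1..n} -> {mpoly k[n]},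
          (forall h, h \in H -> cone h (c h)) /\ p = \sum_(h <- H) c h &
      forall c : 'X_{1..n} -> {mpoly k[n]},
        (forall h, h \in H -> cone h (c h)) -> \sum_(h <- H) c h = 0 ->
        forall h, h \in H -> c h = 0].

Definition pommaret_basis (H : seq {mpoly k[n]}) K : Prop :=
  [/\ forall h, h \in H -> [/\ K h, h != 0 & exists d, h \is d.-homog],
      uniq [seq lm h | h <- H] &
      pommaret_monomial [seq lm h | h <- H] (lead_ideal K)].

(* The empty basis, i.e. that of the zero ideal, gets degree 0 by convention.  *)
Definition basis_degree (H : seq {mpoly k[n]}) : nat :=
  (\max_(h <- H) (msize h).-1)%N.

(* k[y_1, ..., y_D] -> P / I is injective with the y_i algebraically           *)
(* independent, and makes P / I a finite module.                               *)
Definition noether_normalisation I (D : nat) (y : D.-tuple {mpoly k[n]}) :=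
  [/\ forall i : 'I_D, tnth y i \is 1.-homog,
      forall f : {mpoly k[D]}, I (f \mPo y) -> f = 0 &
      exists (l : nat) (w : l.-tuple {mpoly k[n]}), forall p,
        exists c : l.-tuple {mpoly k[D]},
          I (p - \sum_(i < l) (tnth c i \mPo y) * tnth w i)].

Definition reduction I (D : nat) (y : D.-tuple {mpoly k[n]}) :=
  ideal_gen (fun p => I p \/ p \in y).

Definition reduction_number_wrt (J : {mpoly k[n]} -> Prop) (r : nat) : Prop :=
  (exists p, p \is r.-homog /\ ~ J p) /\
  (forall d p, p \is d.-homog -> ~ J p -> (d <= r)%N).

(* D is a parameter here; it is to be the dimension of I.                      *)
Definition reduction_number I (D r : nat) : Prop :=
  (exists y : D.-tuple {mpoly k[n]},
     noether_normalisation I y /\ reduction_number_wrt (reduction I y) r) /\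
  (forall (y : D.-tuple {mpoly k[n]}) s,
     noether_normalisation I y -> reduction_number_wrt (reduction I y) s ->
     (r <= s)%N).

End Polynomials.

(* Below, e stands for n - D.                                                  *)
Section Generic.
Variables (k : fieldType) (n e D : nat).

Definition param_field : fieldType := {fraction {mpoly k[D * e]}}.

Definition param (i : 'I_D) (j : 'I_e) : param_field :=
  tofrac ('X_(mxvec_index i j) : {mpoly k[D * e]}).

Definition const_embed (c : k) : {mpoly param_field[e]} :=
  (tofrac (c%:MP : {mpoly k[D * e]}) : param_field)%:MP.

(* The last case does not occur when n = e + D.                                *)
Definition subst_var (v : 'I_n) : {mpoly param_field[e]} :=
  match (insub (v : nat) : option 'I_e), (insub (v - e)%N : option 'I_D) with
  | Some j, _ => 'X_j
  | None, Some i => - \sum_(j < e) param i j *: 'X_j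
  | None, None => 0
  end.

Definition generic_subst (g : {mpoly k[n]}) : {mpoly param_field[e]} :=
  mmap const_embed subst_var g.

Definition generic_ideal (G : seq {mpoly k[n]}) : {mpoly param_field[e]} -> Prop :=
  ideal_gen (fun p => exists2 g, g \in G & p = generic_subst g).

End Generic.

(* Main.v *)
Require Import Defs.
From mathcomp Require Import all_boot all_order all_algebra.
From mathcomp Require Import mpoly zify ring.
From Stdlib Require Import Classical.
From mathcomp Require classical_sets boolp.
Set Implicit Arguments.
Unset Strict Implicit.
Unset Printing Implicit Defensive.
Import GRing.Theory.
Local Open Scope ring_scope.

(** Write [P] for [k[x_1, ..., x_n]] and [e] for [n - D]. For linear forms
    [y_1, ..., y_D], the number [r_J] of [J = I + <y>] is governed by the degrees
    [d] with [P_d] contained in [J] (here: [covers I y d]). Three ideas give the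
    theorem.

    Openness. That [P_d] lies in [I + <y>] is witnessed by a nonvanishing
    determinant in the coefficients of the [y_i] ([covers_over_open]). Hence it
    holds for some choice of [D] linear forms over the infinite field [k] if and
    only if it holds for the generic forms [x_(e+i) + sum_j a_ij x_j]
    ([covers_normal_form], [covers_generic], [covers_specialize]), and solving
    these for [x_(e+i)] turns the generic statement into: the ideal obtained by
    the substitution contains everything of degree [d] ([covers_elim_image]). So
    the least [r] such that the generic ideal contains everything of degree
    [r + 1] is attained by some [y] over [k], and no [y] does better.

    Dimension. The [y] just found must be a Noether normalisation, and some
    covering [y] with exactly [D] members must exist. If linear forms cover a
    degree, [P / I] is a finite module over [k[y]] ([covers_finite]). A prime
    chain of length [D] yields [D] algebraically independent elements modulo [I]
    ([chain_alg_indep]), so comparing growth rates bounds the number of covering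
    forms below by [D] ([alg_indep_le]). Conversely, [d] covering forms that are
    algebraically independent modulo [I] produce a prime chain of length [d]
    ([alg_indep_chain]), so [d <= D]; and if they are dependent, one form can be
    saved ([covered_by_fewer]). Starting from the variables and saving forms as
    long as possible ends at exactly [D] forms, and [D] covering forms are always
    independent.

    Pommaret bases. Regard a monomial as its sorted word. The cone of [h] then
    consists of the words with prefix [h], so a Pommaret basis of a monomial
    ideal is the set of its minimal words, those all of whose proper prefixes lie
    outside the ideal. If the ideal contains all words of length [r + 1] but not
    some word [t] of length [r], then minimal words have length at most [r + 1],
    and [t] followed by the last variable is minimal; the degree of a Pommaret
    basis is therefore [r + 1] ([pommaret_basis_exists], [basis_degree_pred]). *)

(** * Ideals and primes *)

Section IdealTheory.
Variable R : comNzRingType.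
Implicit Types (I S : R -> Prop) (u v : R).

Lemma ideal_sum I (T : Type) (r : seq T) (P : pred T) (F : T -> R) :
  is_ideal I -> (forall i, P i -> I (F i)) -> I (\sum_(i <- r | P i) F i).
Proof. by case=> I0 ID _ IF; apply: big_ind. Qed.

Lemma ideal_sum_seq I (T : eqType) (r : seq T) (F : T -> R) :
  is_ideal I -> (forall i, i \in r -> I (F i)) -> I (\sum_(i <- r) F i).
Proof. by case=> I0 ID _ IF; rewrite big_seq; apply: big_ind. Qed.

Lemma idealMr I u v : is_ideal I -> I u -> I (u * v).
Proof. by case=> _ _ IM Iu; rewrite mulrC; apply: IM. Qed.

Lemma idealN I u : is_ideal I -> I u -> I (- u).
Proof. by case=> _ _ IM Iu; rewrite -mulN1r; apply: IM. Qed.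

Lemma idealB I u v : is_ideal I -> I u -> I v -> I (u - v).
Proof. by move=> hI Iu Iv; case: (hI) => _ ID _; apply: ID => //; apply: idealN. Qed.

Lemma idealBK I u v : is_ideal I -> I v -> I (u - v) -> I u.
Proof. by move=> hI Iv Iuv; case: (hI) => _ ID _; rewrite -(subrK v u); apply: ID. Qed.

Lemma ideal_gen_ideal S : is_ideal (ideal_gen S).
Proof.
split.
- by exists [::]; split=> //; rewrite big_nil.
- move=> u v [s [Ss ->]] [t [St ->]]; exists (s ++ t); split.
    by move=> w; rewrite mem_cat => /orP[/Ss|/St].
  by rewrite big_cat.
- move=> a u [s [Ss ->]]; exists [seq (a * w.1, w.2) | w <- s]; split.
    by move=> w /mapP[x /Ss Sx ->].
  by rewrite big_map mulr_sumr; apply: eq_bigr => w _; rewrite mulrA.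
Qed.

Lemma mem_ideal_gen S u : S u -> ideal_gen S u.
Proof.
move=> Su; exists [:: (1, u)]; rewrite big_seq1 mul1r; split=> // w.
by rewrite inE => /eqP->.
Qed.

Lemma ideal_gen_min S I : is_ideal I -> (forall u, S u -> I u) ->
  forall u, ideal_gen S u -> I u.
Proof.
move=> hI SI u [s [Ss ->]]; apply: ideal_sum_seq => // w /Ss /SI Iw.
by case: hI => _ _; apply.
Qed.

Lemma ideal_gen_mono S S' :
  (forall u, S u -> ideal_gen S' u) -> forall u, ideal_gen S u -> ideal_gen S' u.
Proof. by move=> SS'; apply: (ideal_gen_min (@ideal_gen_ideal _) SS'). Qed.

(** Zorn's lemma gives an ideal maximal among those above [I] and disjoint from
    [S]. It is prime: if [u] and [v] are outside, adding either one makes the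
    ideal meet [S], and the product of the two elements of [S] would lie in the
    ideal as soon as [u * v] does. *)
Lemma prime_avoiding (I S : R -> Prop) :
  is_ideal I -> S 1 -> (forall u v, S u -> S v -> S (u * v)) ->
  (forall u, I u -> ~ S u) ->
  exists Q, [/\ is_prime Q, forall u, I u -> Q u & forall u, Q u -> ~ S u].
Proof.
move=> hI S1 SM IS.
(* [I] is adjoined so that the union of the empty chain is admissible too. *)
pose adm A := is_ideal (fun u => A u \/ I u) /\ forall u, A u -> ~ S u.
have [|M [[hM MS] Mmax]] := @classical_sets.Zorn_bigcup R adm.
  move=> F FP Ftot; split; last first.
    by move=> u [X FX Xu]; have [_] := FP _ FX; apply.
  split.
  - by right; case: hI.
  - move=> u v [[X FX Xu]|Iu] [[Y FY Yv]|Iv].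
    + have [XY|YX] := Ftot _ _ FX FY.
        have [[_ YD _] _] := FP _ FY.
        have [||Yuv|Iuv] := YD u v; [by left; apply: XY| by left| |by right].
        by left; exists Y.
      have [[_ XD _] _] := FP _ FX.
      have [||Xuv|Iuv] := XD u v; [by left| by left; apply: YX| |by right].
      by left; exists X.
    + have [[_ XD _] _] := FP _ FX.
      have [||Xuv|Iuv] := XD u v; [by left| by right| |by right].
      by left; exists X.
    + have [[_ YD _] _] := FP _ FY.
      have [||Yuv|Iuv] := YD u v; [by right| by left| |by right].
      by left; exists Y.
    + by right; case: hI => _ ID _; apply: ID.
  - move=> a u [[X FX Xu]|Iu]; last by right; case: hI => _ _; apply.
    have [[_ _ XM] _] := FP _ FX.
    by have [|Xau|Iau] := XM a u; [left|left; exists X|right].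
pose Q u := M u \/ I u.
have QS u : Q u -> ~ S u by case=> [/MS|/IS].
have [Q0 QD QM] := hM.
have enlarge u : ~ Q u -> exists q a, Q q /\ S (q + a * u).
  move=> NQu; apply: NNPP => NS.
  pose B v := exists q a, Q q /\ v = q + a * u.
  have BM v : M v -> B v by move=> Mv; exists v, 0; rewrite mul0r addr0; split=> //; left.
  have BI v : I v -> B v by move=> Iv; exists v, 0; rewrite mul0r addr0; split=> //; right.
  apply: (Mmax B).
    split; first exact: BM.
    move=> BsubM; apply: NQu; left; apply: BsubM; exists 0, 1.
    by rewrite mul1r add0r.
  split; last by move=> v [q [a [Qq ->]]] Sv; apply: NS; exists q, a.
  split.
  - by right; case: hI.
  - move=> v w Bv Bw; left.
    have {Bv}[q [a [Qq ->]]] : B v by case: Bv => // /BI.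
    have {Bw}[q' [a' [Qq' ->]]] : B w by case: Bw => // /BI.
    exists (q + q'), (a + a'); split; first exact: QD.
    by rewrite mulrDl addrACA.
  - move=> b v Bv; left; have {Bv}[q [a [Qq ->]]] : B v by case: Bv => // /BI.
    exists (b * q), (b * a); split; first exact: QM.
    by rewrite mulrDr mulrA.
exists Q; split; [|by right|exact: QS].
split; first exact: hM.
  by move=> Q1; apply: (QS 1).
move=> u v Quv; apply: NNPP => Nuv.
have [|q [a [Qq Sa]]] := enlarge u; first by move=> Qu; apply: Nuv; left.
have [|q' [a' [Qq' Sa']]] := enlarge v; first by move=> Qv; apply: Nuv; right.
apply: (QS ((q + a * u) * (q' + a' * v))); last exact: SM.
have -> : (q + a * u) * (q' + a' * v) =
  (q' + a' * v) * q + ((a * u) * q' + (a * a') * (u * v)) by ring.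
by apply: (QD); [exact: QM | apply: (QD); exact: QM].
Qed.

End IdealTheory.

(** * Linear forms and homogeneous ideals *)

Section Homogeneous.
Variables (n : nat) (R : comNzRingType).
Implicit Types (p q : {mpoly R[n]}) (m : 'X_{1..n}).

Lemma mcoeff_pihomog d p m :
  (pihomog mdeg d p)@_m = if mdeg m == d then p@_m else 0.
Proof.
rewrite {2}[p]mpolyE /pihomog !raddf_sum /= big_mkcond.
have [<-|ne] := eqVneq (mdeg m) d.
  apply: eq_bigr => m' _; case: ifP => // ne; rewrite mcoeffZ mcoeffX.
  have [eq_m|_] := eqVneq m' m; last by rewrite mulr0.
  by rewrite eq_m eqxx in ne.
rewrite big1 // => m' _; case: ifP => // /eqP eq_d.
rewrite mcoeffZ mcoeffX; case: eqVneq => [eq_m|]; last by rewrite mulr0.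
by rewrite -eq_m eq_d eqxx in ne.
Qed.

Lemma pihomogM_homog d e p q : q \is e.-homog ->
  pihomog mdeg (d + e)%N (p * q) = pihomog mdeg d p * q.
Proof.
move=> hq; rewrite {1 2}(pihomog_partitionE (leqnn (msize p))).
rewrite mulr_suml !raddf_sum mulr_suml; apply: eq_bigr => i _ /=.
have hi := pihomogP mdeg i p; have [<-|ne] := eqVneq (i : nat) d.
  by rewrite (pihomog_dE (dhomogM hi hq)) (pihomog_dE hi).
rewrite [in RHS](pihomog_ne0 ne hi) mul0r (@pihomog_ne0 _ _ _ (i + e)%N) //.
  by rewrite eqn_add2r.
exact: dhomogM.
Qed.

Lemma pihomogM_homog_lt d e p q : (d < e)%N -> q \is e.-homog ->
  pihomog mdeg d (p * q) = 0.
Proof.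
move=> lt_de hq; rewrite {1}(pihomog_partitionE (leqnn (msize p))).
rewrite mulr_suml !raddf_sum big1 // => i _ /=.
apply: (@pihomog_ne0 _ _ _ (i + e)%N); last by apply: dhomogM => //; apply: pihomogP.
by rewrite neq_ltn (leq_trans lt_de) ?orbT // leq_addl.
Qed.

Lemma homog_in_ideal (I : {mpoly R[n]} -> Prop) d p : is_ideal I ->
  (forall m, mdeg m = d -> I 'X_[m]) -> p \is d.-homog -> I p.
Proof.
move=> hI IX /dhomogP hp; rewrite [p]mpolyE; apply: ideal_sum_seq => // m /hp md.
by rewrite -mul_mpolyC; case: hI => _ _; apply; apply: IX.
Qed.

Lemma msizeS_homog d p : p \is d.-homog -> p != 0 -> msize p = d.+1.
Proof.
move=> hp p0; have := dhomog_uniq p0 hp (dhomog_msize hp) => ->.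
by rewrite -mpolySpred.
Qed.

Lemma ideal_gen_homogeneous (S : {mpoly R[n]} -> Prop) :
  (forall p d, S p -> S (pihomog mdeg d p)) ->
  forall p d, ideal_gen S p -> ideal_gen S (pihomog mdeg d p).
Proof.
move=> hS p d [s [Ss ->]]; rewrite raddf_sum.
have hgen := ideal_gen_ideal S.
apply: ideal_sum_seq => // -[a u] /Ss /= Su.
rewrite [u](pihomog_partitionE (leqnn (msize u))) mulr_sumr raddf_sum.
apply: ideal_sum => // i _ /=.
have hi := pihomogP mdeg i u.
have Si : ideal_gen S (pihomog mdeg i u) by apply: mem_ideal_gen; apply: hS.
have [lt_di|le_id] := ltnP d i.
  by rewrite (pihomogM_homog_lt _ lt_di hi); case: hgen.
rewrite -(subnK le_id) pihomogM_homog //.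
by case: hgen => _ _; apply.
Qed.

End Homogeneous.

Lemma mnm_split n (m : 'X_{1..n}) a : (a <= mdeg m)%N ->
  exists m1 m2, m = (m1 + m2)%MM /\ mdeg m1 = a.
Proof.
elim: a => [|a IH] lt_am; first by exists 0%MM, m; rewrite add0m mdeg0.
have [m1 [m2 [eq_m deg1]]] := IH (ltnW lt_am).
have [i m2i] : exists i, m2 i != 0%N.
  apply/existsP; apply: contraLR lt_am; rewrite negb_exists => /forallP m20.
  have -> : m = m1.
    by apply/mnmP=> i; rewrite eq_m mnmDE; move: (m20 i); rewrite negbK => /eqP->; rewrite addn0.
  by rewrite deg1 ltnn.
exists (m1 + U_(i))%MM, (m2 - U_(i))%MM; split; last by rewrite mdegD mdeg1 deg1 addn1.
rewrite -addmA [(U_(i) + _)%MM]addmC submK //.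
by rewrite lep1mP.
Qed.

Lemma map_mpoly_pihomog n (R S : comNzRingType) (f : {rmorphism R -> S}) d
    (p : {mpoly R[n]}) :
  pihomog mdeg d (map_mpoly f p) = map_mpoly f (pihomog mdeg d p).
Proof.
apply/mpolyP=> m; rewrite mcoeff_map_mpoly !mcoeff_pihomog mcoeff_map_mpoly.
by case: ifP; rewrite ?raddf0.
Qed.

Section Reduction.
Variables (n : nat) (k : fieldType) (I : {mpoly k[n]} -> Prop).
Hypothesis hI : homogeneous_ideal I.
Implicit Types (p q : {mpoly k[n]}).

Let idI : is_ideal I. Proof. by case: hI. Qed.

Lemma reduction_ideal D (y : D.-tuple {mpoly k[n]}) : is_ideal (reduction I y).
Proof. exact: ideal_gen_ideal. Qed.

Lemma reductionP D (y : D.-tuple {mpoly k[n]}) p :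
  reduction I y p <-> exists q a, I q /\ p = q + \sum_(i < D) a i * tnth y i.
Proof.
split=> [|[q [a [Iq ->]]]].
  apply: (@ideal_gen_min _ _ (fun p => exists q a, I q /\ p = q + \sum_(i < D) a i * tnth y i)) => {p} [|p].
    split.
    - exists 0, (fun=> 0); split; first by case: idI.
      by rewrite add0r big1 // => i _; rewrite mul0r.
    - move=> u v [q [a [Iq ->]]] [q' [a' [Iq' ->]]].
      exists (q + q'), (fun i => a i + a' i); split; first by case: idI => _ + _; apply.
      by rewrite addrACA -big_split; congr (_ + _); apply: eq_bigr => i _; rewrite mulrDl.
    - move=> b u [q [a [Iq ->]]]; exists (b * q), (fun i => b * a i); split.
        by case: idI => _ _; apply.
      by rewrite mulrDr mulr_sumr; congr (_ + _); apply: eq_bigr => i _; rewrite mulrA.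
  case=> [Ip|/tnthP[i ->]].
    by exists p, (fun=> 0); rewrite big1 ?addr0 // => i _; rewrite mul0r.
  exists 0, (fun j => (i == j)%:R); split; first by case: idI.
  rewrite add0r (bigD1 i) //= eqxx mul1r big1 ?addr0 // => j /negbTE.
  by rewrite eq_sym => ->; rewrite mul0r.
have [_ rD rM] := reduction_ideal y.
apply: rD; first by apply: mem_ideal_gen; left.
apply: ideal_sum; first exact: reduction_ideal.
by move=> i _; apply: rM; apply: mem_ideal_gen; right; apply: mem_tnth.
Qed.

Definition linear_forms D (y : D.-tuple {mpoly k[n]}) :=
  forall i, tnth y i \is 1.-homog.

(** For linear forms, that this holds for some [d] is the graded way of saying
    that [I + <y>] is zero-dimensional: higher degrees follow. *)
Definition covers D (y : D.-tuple {mpoly k[n]}) d :=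
  forall p, p \is d.-homog -> reduction I y p.

Lemma coversS D (y : D.-tuple {mpoly k[n]}) d d' :
  (d <= d')%N -> covers y d -> covers y d'.
Proof.
move=> le_dd' cov p; apply: homog_in_ideal => [|m deg_m]; first exact: reduction_ideal.
have [|m1 [m2 [-> deg1]]] := @mnm_split n m d; first by rewrite deg_m.
rewrite mpolyXD mulrC; case: (reduction_ideal y) => _ _; apply; apply: cov.
by rewrite dhomogX; apply/eqP.
Qed.

(** Graded Nakayama: if [P / (I + <y>)] vanishes in degree [d], then the
    monomials of degree less than [d] generate [P / I] over [k[y]], because
    everything else is [y]-multiples of elements of lower degree. The degree
    bound on the coefficients is what the dimension count needs. *)
Lemma covers_finite D (y : D.-tuple {mpoly k[n]}) d :
  linear_forms y -> covers y d ->
  exists (l : nat) (w : l.-tuple {mpoly k[n]}), forall p,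
    exists c : l.-tuple {mpoly k[D]},
      (forall i, msize (tnth c i) <= msize p)%N /\
      I (p - \sum_(i < l) (tnth c i \mPo y) * tnth w i).
Proof.
move=> liny cov.
pose l := #|{: 'X_{1..n < d}}|.
pose w := [tuple 'X_[bmnm (enum_val i)] : {mpoly k[n]} | i < l].
exists l, w.
pose ev (c : 'I_l -> {mpoly k[D]}) := \sum_(i < l) (c i \mPo y) * tnth w i.
pose M N p := exists c, (forall i, msize (c i) <= N)%N /\ I (p - ev c).
suff H : forall N p, (msize p <= N)%N -> M N p.
  move=> p; have [c [sc Ip]] := H _ p (leqnn _).
  exists [tuple c i | i < l]; split=> [i|]; first by rewrite tnth_mktuple.
  by under eq_bigr => i _ do rewrite tnth_mktuple.
move=> N0 p0 le_p0; have MI N q : I q -> M N q.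
  move=> Iq; exists (fun=> 0); split=> [i|]; first by rewrite msize0.
  rewrite /ev big1 ?subr0 // => i _.
  by rewrite comp_mpoly0 mul0r.
have MD N q q' : M N q -> M N q' -> M N (q + q').
  move=> [c [sc Iq]] [c' [sc' Iq']]; exists (fun i => c i + c' i); split=> [i|].
    by rewrite (leq_trans (msizeD_le _ _)) // geq_max sc sc'.
  suff -> : q + q' - ev (fun i => c i + c' i) = (q - ev c) + (q' - ev c').
    by case: idI => _ + _; apply.
  rewrite addrACA -opprD /ev -big_split /=; congr (_ - _).
  by apply: eq_bigr => i _; rewrite comp_mpolyD mulrDl.
have M_sum N (T : Type) (r : seq T) (P : pred T) (F : T -> {mpoly k[n]}) :
    (forall i, P i -> M N (F i)) -> M N (\sum_(i <- r | P i) F i).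
  by move=> MF; apply: big_ind => //; [apply: MI; case: idI | exact: MD].
have MZ N a q : M N q -> M N (a *: q).
  move=> [c [sc Iq]]; exists (fun i => a *: c i); split=> [i|].
    by rewrite (leq_trans (msizeZ_le _ _)).
  suff -> : a *: q - ev (fun i => a *: c i) = a%:MP * (q - ev c).
    by case: idI => _ _; apply.
  rewrite mulrBr !mul_mpolyC; congr (_ - _).
  by rewrite /ev scaler_sumr; apply: eq_bigr => i _; rewrite comp_mpolyZ scalerAl.
have My N q i : M N q -> M N.+1 (q * tnth y i).
  move=> [c [sc Iq]]; exists (fun j => c j * 'X_i); split=> [j|].
    have [->|cj0] := eqVneq (c j) 0; first by rewrite mul0r msize0.
    rewrite msizeM //; last by rewrite -msize_poly_eq0 mmeasureX.
    by rewrite msizeX mdeg1 addn2 /= ltnS.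
  suff -> : q * tnth y i - ev (fun j => c j * 'X_i) = (q - ev c) * tnth y i.
    exact: idealMr.
  rewrite mulrBl; congr (_ - _); rewrite /ev mulr_suml; apply: eq_bigr => j _.
  by rewrite rmorphM /= comp_mpolyXU -tnth_nth mulrAC.
have MW N N' q : (N <= N')%N -> M N q -> M N' q.
  by move=> le [c [sc Iq]]; exists c; split=> // i; apply: leq_trans le.
suff Mhom t : forall q, q \is t.-homog -> M t.+1 q.
  rewrite [p0](pihomog_partitionE (leqnn (msize p0))).
  apply: M_sum => i _; apply: MW (Mhom _ _ (pihomogP _ _ _)).
  exact: leq_trans le_p0.
elim/ltn_ind: t => t IH q; have [lt_td|le_dt] := ltnP t d.
  move=> /dhomogP hq; rewrite [q]mpolyE big_seq; apply: M_sum => m /hq deg_m.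
  apply: MZ; have lt_md : (mdeg m < d)%N by rewrite deg_m.
  pose i0 := enum_rank (BMultinom lt_md).
  exists (fun i => (i == i0)%:R); split=> [i|].
    by case: (i == i0); rewrite ?msize1 ?msize0.
  rewrite /ev (bigD1 i0) //= eqxx comp_mpoly1 mul1r big1 => [|i /negbTE->].
    by rewrite addr0 tnth_mktuple enum_rankK subrr; case: idI.
  by rewrite comp_mpoly0 mul0r.
move=> hq; have /reductionP[u [a [Iu eq_q]]] := coversS le_dt cov hq.
have Iu' : I (pihomog mdeg t u) by case: hI => _; apply.
rewrite -(pihomog_dE hq) eq_q raddfD raddf_sum /=; apply: MD; first exact: MI.
apply: M_sum => i _; case: t {le_dt hq Iu'} IH => [|t] IH.
  by rewrite (pihomogM_homog_lt _ _ (liny i)) //; apply: MI; case: idI.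
rewrite -[t.+1]addn1 (pihomogM_homog _ _ (liny i)) addn1; apply: My.
exact/IH/pihomogP.
Qed.

End Reduction.

(** * Algebraic independence and the length of prime chains *)

(** Evaluation in two stages, the last variable separately; this turns
    inductions on the number of variables into inductions on univariate
    polynomials. *)
Lemma mmap_muni n (R S : comNzRingType) (f : {rmorphism R -> S})
    (h : 'I_n.+1 -> S) (F : {mpoly R[n.+1]}) :
  mmap f h F =
  (map_poly (mmap f (fun i => h (widen_ord (leqnSn n) i))) (muni F)).[h ord_max].
Proof.
pose g : {rmorphism {mpoly R[n]} -> S} := mmap f (fun i => h (widen_ord (leqnSn n) i)).
rewrite -[mmap f (fun i => h (widen_ord _ i))]/(g : _ -> _).
rewrite muniE rmorph_sum horner_sum [LHS]/mmap; apply: eq_bigr => m _ /=.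
rewrite map_polyZ map_polyXn hornerZ hornerXn [g _]mmapZ mmapX -mulrA.
congr (_ * _); rewrite /mmap1 big_ord_recr /=; congr (_ * _).
by apply: eq_bigr => i _; rewrite mnmE.
Qed.

Lemma muni_eq0 n (R : comNzRingType) (F : {mpoly R[n.+1]}) : muni F = 0 -> F = 0.
Proof.
move=> F0; rewrite -[F]comp_mpoly_id /comp_mpoly mmap_muni F0.
by rewrite raddf0 horner0.
Qed.

Lemma infinite_nonroot (k : fieldType) (p : {poly k}) :
  infinite_type k -> p != 0 -> exists x, p.[x] != 0.
Proof.
move=> hk p0; apply: NNPP => Nx.
have [s [us ss]] : exists s : seq k, uniq s /\ size s = size p.
  elim: (size p) => [|j [s [us ss]]]; first by exists [::].
  by have [x xs] := hk s; exists (x :: s); rewrite /= xs us ss.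
have : all (root p) s.
  by apply/allP => x _; apply/negPn/negP => rx; apply: Nx; exists x.
by move=> /(max_poly_roots p0)/(_ us); rewrite ss ltnn.
Qed.

Lemma infinite_mpoly_nonroot (k : fieldType) : infinite_type k ->
  forall n (F : {mpoly k[n]}), F != 0 -> exists v, F.@[v] != 0.
Proof.
move=> hk; elim=> [|n IH] F F0.
  exists (fun=> 0); rewrite [F]nvar0_mpolyC mevalC.
  by apply: contra_neq F0 => F0; rewrite [F]nvar0_mpolyC F0 mpolyC0.
have uF0 : muni F != 0 by apply: contra_neq F0 => /muni_eq0.
have [|v lv] := IH (lead_coef (muni F)); first by rewrite lead_coef_eq0.
have [|x px] := @infinite_nonroot k (map_poly (meval v) (muni F)) hk.
  apply: contra_neq lv => /(congr1 (fun p : {poly k} => p`_(size (muni F)).-1)).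
  by rewrite coef_map coef0.
pose h (i : 'I_n.+1) := if insub (i : nat) is Some j then v j else x.
exists h; apply: contra_neq px; rewrite /meval mmap_muni => e; rewrite -[RHS]e.
have -> : h ord_max = x by rewrite /h insubF //= ltnn.
congr (_.[_]); apply: eq_map_poly => q; apply: eq_bigr => m _; congr (_ * _).
apply: mmap1_eq => i; rewrite /h /=; case: insubP => [j _ /val_inj->//|].
by rewrite ltn_ord.
Qed.

Section Counting.
Variables (n : nat) (k : fieldType).
Implicit Types (I Q : {mpoly k[n]} -> Prop).

(** Choose [f i] in the [i]-th prime of the chain but not in the previous one.
    A relation between the [f i] modulo the smallest prime becomes, modulo the
    next prime, a relation between all but one of them, which is trivial by
    induction; so the relation is divisible by the remaining variable, and that
    factor can be cancelled since its value is not in the smallest prime. *)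
Lemma chain_alg_indep D (Q : nat -> {mpoly k[n]} -> Prop) :
  prime_chain (Q 0%N) D Q ->
  exists f : 'I_D -> {mpoly k[n]},
    forall F, Q 0%N (mmap (@mpolyC n k) f F) -> F = 0.
Proof.
elim: D Q => [|D IH] Q [Qprime _ Qchain].
  exists (fun=> 0) => F; rewrite [F]nvar0_mpolyC mmapC => QF.
  have [[_ _ QM] Q1 _] := Qprime 0%N isT.
  have [->|c0] := eqVneq (F@_0%MM) 0; first by rewrite mpolyC0.
  by case: Q1; rewrite -mpolyC1 -(mulVf c0) mpolyCM; apply: QM.
have [|f fQ] := IH (fun i => Q i.+1).
  by split=> // i lt_iD; [apply: Qprime | apply: Qchain].
have [Q01 [x [Q1x Q0x]]] := Qchain 0%N isT.
have [Q1id Q1p _] := Qprime 1%N isT; have [Q0id _ Q0pr] := Qprime 0%N isT.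
pose g (i : 'I_D.+1) := if insub (i : nat) is Some j then f j else x.
exists g => F; rewrite mmap_muni.
have -> : g ord_max = x by rewrite /g insubF //= ltnn.
rewrite (@eq_map_poly _ _ _ (mmap (@mpolyC n k) f)) => [QF|q]; last first.
  apply: eq_bigr => m _; congr (_ * _).
  apply: mmap1_eq => i; rewrite /g /=; case: insubP => [j _ /val_inj->//|].
  by rewrite ltn_ord.
apply: muni_eq0; move: (muni F) QF => {F}; elim/poly_ind => // p c IHp.
rewrite rmorphD rmorphM /= map_polyX map_polyC /= !hornerE => Qpc.
have Q1px : Q 1%N ((map_poly (mmap (@mpolyC n k) f) p).[x] * x).
  by case: Q1id => _ _; apply.
have c0 : c = 0.
  by apply: fQ; move: (idealB Q1id (Q01 _ Qpc) Q1px); rewrite addrAC subrr add0r.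
move: Qpc; rewrite c0 mmap0 addr0 polyC0 addr0 => /Q0pr[/IHp->|//].
by rewrite mul0r.
Qed.

Lemma card_bmultinom_le d N : (#|{: 'X_{1..d < N}}| <= N ^ d)%N.
Proof.
have lt_N (m : 'X_{1..d < N}) (i : 'I_d) : (m i < N)%N.
  apply: leq_ltn_trans (bmdeg m); rewrite mdegE (bigD1 i) //=; exact: leq_addr.
pose h (m : 'X_{1..d < N}) := [ffun i : 'I_d => Ordinal (lt_N m i)].
have h_inj : injective h.
  move=> m m' /ffunP eq_h; apply: val_inj; apply/mnmP => i.
  by have := eq_h i; rewrite !ffunE => -[].
by rewrite -(card_codom h_inj) (leq_trans (max_card _)) // card_ffun !card_ord.
Qed.

Lemma msize_prod (T : Type) (r : seq T) (F : T -> {mpoly k[n]}) (b : T -> nat) :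
  (forall i, msize (F i) <= (b i).+1)%N ->
  (msize (\prod_(i <- r) F i) <= (\sum_(i <- r) b i).+1)%N.
Proof.
move=> hF; elim: r => [|i r IHr]; first by rewrite !big_nil msize1.
rewrite !big_cons; have [->|Fi0] := eqVneq (F i) 0; first by rewrite mul0r msize0.
have [->|pr0] := eqVneq (\prod_(j <- r) F j) 0; first by rewrite mulr0 msize0.
by rewrite msizeM // -subn1 leq_subLR add1n -addnS -addSn leq_add.
Qed.

(** A growth count: [D] elements that are algebraically independent modulo [I]
    have about [m ^ D] independent monomials of exponents less than [m], whose
    degrees are [O(m)], whereas a module of finite type over [d] linear forms
    has only [O(m ^ d)] dimensions in degrees [O(m)]. *)
Lemma alg_indep_le I D d (f : 'I_D -> {mpoly k[n]}) (y : d.-tuple {mpoly k[n]})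
    l (w : l.-tuple {mpoly k[n]}) : is_ideal I ->
  (forall F, I (mmap (@mpolyC n k) f F) -> F = 0) ->
  (forall p, exists c : l.-tuple {mpoly k[d]},
      (forall i, msize (tnth c i) <= msize p)%N /\
      I (p - \sum_(i < l) (tnth c i \mPo y) * tnth w i)) ->
  (D <= d)%N.
Proof.
move=> idI findep wgen; rewrite leqNgt; apply/negP => lt_dD.
(* [N] bounds the size of the monomials in [f] with exponents below [m], and
   [m] is large enough for [l * N ^ d < m ^ d.+1]. *)
pose c := (\max_(i < D) msize (f i))%N.
pose m := (l * (D * c + 1) ^ d + 1)%N.
pose N := (m * (D * c + 1))%N.
have m_gt0 : (0 < m)%N by rewrite /m addn1.
have big : (l * N ^ d < m ^ D)%N.
  rewrite /N expnMn mulnCA; apply: (@leq_trans (m ^ d.+1)); last first.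
    by rewrite leq_pexp2l.
  by rewrite expnSr ltn_pmul2l ?expn_gt0 ?m_gt0 //= /m [X in (_ < X)%N]addn1.
pose A := {ffun 'I_D -> 'I_m}.
pose mon (a : A) : 'X_{1..D} := [multinom (a i : nat) | i < D].
have mon_inj : injective mon.
  move=> a b /mnmP eq_ab; apply/ffunP => i; apply: val_inj.
  by have := eq_ab i; rewrite !mnmE.
have size_mon a : (msize (mmap (@mpolyC n k) f 'X_[mon a]) <= N)%N.
  rewrite mmapX /mmap1; apply: (@leq_trans (\sum_(i < D) m * c).+1).
    apply: msize_prod => i; apply: (@leq_trans (\sum_(j <- iota 0 (mon a i)) c).+1).
      have -> : f i ^+ mon a i = \prod_(j <- iota 0 (mon a i)) f i.
        by rewrite big_const_seq count_predT size_iota -Monoid.iteropE.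
      apply: msize_prod => j; apply: leqW.
      by rewrite /c (bigD1 i) //= leq_maxl.
    rewrite ltnS big_const_seq count_predT size_iota iter_addn_0 mulnC leq_mul2r.
    by rewrite mnmE ltnW ?orbT.
  rewrite sum_nat_const card_ord /N mulnDr muln1 mulnCA -addn1 leq_add2l //.
have [coef coefP] := fin_all_exists (fun a => wgen (mmap (@mpolyC n k) f 'X_[mon a])).
pose B := ('I_l * 'X_{1..d < N})%type.
(* Row [a] holds the coefficients of the expression of [f ^ a] through [y] and
   [w]; there are more rows than columns, so the rows are dependent. *)
pose M : 'M[k]_(#|{: A}|, #|{: B}|) :=
  \matrix_(r, s) let: (i, b) := enum_val s : B in
    (tnth (coef (enum_val r : A)) i)@_(bmnm b).
have rankM : (\rank M < #|{: A}|)%N.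
  apply: leq_ltn_trans (rank_leq_col _) _.
  rewrite card_prod card_ffun !card_ord; apply: leq_ltn_trans big.
  by rewrite leq_mul2l card_bmultinom_le orbT.
have ker_neq0 : kermx M != 0 by rewrite -mxrank_eq0 mxrank_ker -lt0n subn_gt0.
pose u := nz_row (kermx M).
have uM : u *m M = 0 by apply/sub_kermxP/nz_row_sub.
pose F : {mpoly k[D]} := \sum_(r < #|{: A}|) u 0 r *: 'X_[mon (enum_val r)].
have coefF r : F@_(mon (enum_val r)) = u 0 r.
  rewrite /F raddf_sum (bigD1 r) //= mcoeffZ mcoeffX eqxx mulr1 big1 ?addr0 //.
  move=> r' ne; rewrite mcoeffZ mcoeffX; case: eqVneq => [/mon_inj/enum_val_inj eq_r|].
    by rewrite eq_r eqxx in ne.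
  by rewrite mulr0.
have F0 : F = 0.
  apply: findep.
  suff -> : mmap (@mpolyC n k) f F = \sum_r (u 0 r)%:MP *
      (mmap (@mpolyC n k) f 'X_[mon (enum_val r)] -
       \sum_(i < l) (tnth (coef (enum_val r)) i \mPo y) * tnth w i).
    apply: ideal_sum => // r _; case: (idI) => _ _; apply.
    by have [] := coefP (enum_val r).
  under [RHS]eq_bigr => r _ do rewrite mulrBr.
  rewrite raddf_sum -[LHS]subr0 sumrB; congr (_ - _).
    by apply: eq_bigr => r _ /=; exact: mmapZ.
  apply/esym; under eq_bigr => r _ do rewrite mulr_sumr.
  rewrite exchange_big big1 // => i _ /=.
  rewrite (_ : \sum_r _ = ((\sum_r u 0 r *: tnth (coef (enum_val r)) i) \mPo y) * tnth w i).
    rewrite (_ : \sum_r _ = 0) ?comp_mpoly0 ?mul0r //.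
    apply/mpolyP => b; rewrite mcoeff0 raddf_sum /=.
    have [lt_bN|le_Nb] := ltnP (mdeg b) N.
      have /matrixP/(_ 0 (enum_rank (i, BMultinom lt_bN))) := uM.
      rewrite !mxE => {2}<-; apply: eq_bigr => r _.
      by rewrite !mxE enum_rankK mcoeffZ.
    rewrite big1 // => r _; rewrite mcoeffZ memN_msupp_eq0 ?mulr0 //.
    apply: msize_mdeg_ge; apply: leq_trans le_Nb.
    by have [sc _] := coefP (enum_val r); apply: leq_trans (sc i) (size_mon _).
  rewrite raddf_sum mulr_suml; apply: eq_bigr => r _ /=.
  by rewrite comp_mpolyZ mul_mpolyC scalerAl.
case/negP: ker_neq0; rewrite -nz_row_eq0; apply/eqP/rowP => r.
by rewrite -/u -coefF F0 mcoeff0 mxE.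
Qed.

End Counting.

(** * Prime chains from algebraically independent forms *)

(** The determinant is a polynomial in [t]; its value at [0] is [g ^+ l]. *)
Lemma det_scalar_sub_scale (R : comNzRingType) l (g t : R) (C : 'M[R]_l) :
  exists b, \det (g%:M - t *: C) = g ^+ l + t * b.
Proof.
pose p : {poly R} := \det (map_mx polyC g%:M - 'X *: map_mx polyC C).
have pE x : p.[x] = \det (g%:M - x *: C).
  rewrite -[LHS]/(horner_eval x p) -det_map_mx; congr (\det _).
  by apply/matrixP => i j; rewrite !mxE /= /horner_eval !hornerE.
have [[q c] /= eq_p] : exists qc, p = qc.1 * 'X + qc.2%:P.
  by elim/poly_ind: p {pE} => [|q c _]; [exists (0, 0); rewrite mul0r add0r | exists (q, c)].
exists q.[t]; rewrite -pE -(det_scalar l g).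
have <- : p.[0] = \det (g%:M : 'M_l) by rewrite pE scale0r subr0.
by rewrite eq_p !hornerE addrC [t * _]mulrC.
Qed.

Lemma mmap_comp n d (R : comNzRingType) (S : comNzRingType)
    (f : {rmorphism R -> S}) (h : 'I_d -> S) (lq : n.-tuple {mpoly R[d]})
    (F : {mpoly R[n]}) :
  mmap f h (F \mPo lq) = mmap f (fun i => mmap f h (tnth lq i)) F.
Proof.
rewrite comp_mpolyE raddf_sum; apply: eq_bigr => m _ /=.
rewrite mmapZ; congr (_ * _); rewrite rmorph_prod; apply: eq_bigr => i _.
by rewrite rmorphXn.
Qed.

Section PrimeChain.
Variables (n d : nat) (k : fieldType).
Variables (y : d.-tuple {mpoly k[n]}) (l : nat) (w : l.-tuple {mpoly k[n]}).
Implicit Types (I J Q : {mpoly k[n]} -> Prop) (F : {mpoly k[d]}).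

Definition spans_mod J := forall p, exists c : l.-tuple {mpoly k[d]},
  J (p - \sum_(i < l) (tnth c i \mPo y) * tnth w i).

(** The determinant trick: modulo [J], multiplication by [g(y)] maps the finite
    module [P / J] into its multiple by [t(y)]. *)
Lemma determinant_trick J (g t : {mpoly k[d]}) (h : {mpoly k[n]}) :
  is_ideal J -> spans_mod J -> J ((g \mPo y) - (t \mPo y) * h) ->
  exists b, J ((g ^+ l + t * b) \mPo y).
Proof.
move=> hJ wJ Jgt; have [J0 JD JM] := hJ.
have [c cP] := fin_all_exists (fun i : 'I_l => wJ (h * tnth w i)).
(* [C] describes multiplication by [h] on the generators [w], so [B] maps [w]
   into [J]; multiplying by the adjugate, so does [\det B]. *)
pose C := \matrix_(i, j) tnth (c i) j.
pose B := g%:M - t *: C.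
have [b detB] := det_scalar_sub_scale g t C; exists b; rewrite -detB -/B.
have BJ i : J (\sum_j (B i j \mPo y) * tnth w j).
  suff -> : \sum_j (B i j \mPo y) * tnth w j =
    tnth w i * ((g \mPo y) - (t \mPo y) * h) +
    (t \mPo y) * (h * tnth w i - \sum_j (tnth (c i) j \mPo y) * tnth w j).
    by apply: (JD); apply: (JM) => //; apply: cP.
  have -> : \sum_j (B i j \mPo y) * tnth w j =
    (g \mPo y) * tnth w i - (t \mPo y) * \sum_j (tnth (c i) j \mPo y) * tnth w j.
    transitivity (\sum_j ((if j == i then (g \mPo y) * tnth w j else 0) -
        (t \mPo y) * ((tnth (c i) j \mPo y) * tnth w j))); last first.
      by rewrite sumrB mulr_sumr -big_mkcond big_pred1_eq.
    apply: eq_bigr => j _; rewrite !mxE rmorphB rmorphM /= eq_sym mulrBl mulrA.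
    congr (_ - _); case: eqVneq => _; rewrite ?mulr1n // mulr0n.
    by rewrite comp_mpoly0 mul0r.
  by ring.
have detw i : J ((\det B \mPo y) * tnth w i).
  suff -> : (\det B \mPo y) * tnth w i =
      \sum_m (\adj B i m \mPo y) * \sum_j (B m j \mPo y) * tnth w j.
    by apply: ideal_sum => // m _; apply: JM.
  under eq_bigr => m _ do rewrite mulr_sumr.
  rewrite exchange_big /=.
  transitivity (\sum_j ((\adj B *m B) i j \mPo y) * tnth w j).
    rewrite mul_adj_mx (bigD1 i) //= big1 ?addr0; first by rewrite mxE eqxx mulr1n.
    by move=> j /negbTE ne; rewrite mxE eq_sym ne mulr0n comp_mpoly0 mul0r.
  apply: eq_bigr => j _; rewrite mxE raddf_sum mulr_suml; apply: eq_bigr => m _ /=.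
  by rewrite rmorphM /= mulrA.
have [e eP] := wJ 1.
pose v := \sum_(i < l) (tnth e i \mPo y) * ((\det B \mPo y) * tnth w i).
apply: (@idealBK _ J _ v) => //.
  by apply: ideal_sum => // i _; apply: JM.
suff -> : (\det B \mPo y) - v =
    (\det B \mPo y) * (1 - \sum_(i < l) (tnth e i \mPo y) * tnth w i) by apply: JM.
rewrite /v; move: (\det B \mPo y) => dB; rewrite mulrBr mulr1 mulr_sumr; congr (_ - _).
by apply: eq_bigr => i _; rewrite mulrCA.
Qed.

(** The kernel is the [i]-th prime [(z_1, ..., z_i)] of the standard chain of
    [k[z_1, ..., z_d]]. *)
Definition kill_vars i F := F \mPo [tuple if (j < i)%N then 0 else 'X_j | j < d].

Lemma kill_vars0 F : kill_vars 0 F = F.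
Proof. by rewrite /kill_vars -[RHS]comp_mpoly_id. Qed.

Lemma kill_varsX i (j : 'I_d) : kill_vars i 'X_j = if (j < i)%N then 0 else 'X_j.
Proof. by rewrite /kill_vars comp_mpolyXU -tnth_nth tnth_mktuple. Qed.

Lemma kill_varsS i F : kill_vars i.+1 (kill_vars i F) = kill_vars i.+1 F.
Proof.
rewrite {1 2}/kill_vars /comp_mpoly mmap_comp; apply: eq_bigr => m _.
congr (_ * _); apply: mmap1_eq => j; rewrite !tnth_mktuple.
case: ifP => lt_ji; first by rewrite raddf0 ltnS ltnW.
by rewrite mmapX mmap1U tnth_mktuple.
Qed.

(** The standard chain [0 < (z_1) < (z_1, z_2) < ...] of [k[z]] lifts to [P]:
    the next prime is an ideal maximal among those that contain the previous
    one and [y_(i+1)] and avoid the polynomials in [y] outside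
    [(z_1, ..., z_(i+1))]; the determinant trick shows that the smallest
    candidate does avoid them. *)
Lemma alg_indep_chain I : is_ideal I -> spans_mod I ->
  (forall F, I (F \mPo y) -> F = 0) -> exists Q : nat -> {mpoly k[n]} -> Prop, prime_chain I d Q.
Proof.
move=> hI wI Iinj.
(* The values at [y] of the polynomials outside the [i]-th prime of the standard
   chain. *)
pose S i u := exists F, u = F \mPo y /\ kill_vars i F != 0.
have S1 i : S i 1.
  by exists 1; rewrite comp_mpoly1 /kill_vars comp_mpoly1 oner_eq0.
have SM i u v : S i u -> S i v -> S i (u * v).
  move=> [F [-> F0]] [G [-> G0]]; exists (F * G).
  by rewrite rmorphM /kill_vars rmorphM /= mulf_neq0.
suff chain i : (i <= d)%N -> exists Q : nat -> {mpoly k[n]} -> Prop,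
    prime_chain I i Q /\ (forall F, Q i (F \mPo y) -> kill_vars i F = 0).
  by have [Q [QP _]] := chain d (leqnn d); exists Q.
elim: i => [_|i IH lt_id].
  have [|Q [Qp IQ QS]] := prime_avoiding hI (S1 0%N) (SM 0%N).
    by move=> u Iu [F [eq_u]]; rewrite kill_vars0 (Iinj F) ?eqxx // -eq_u.
  exists (fun=> Q); split; first by split.
  by move=> F QF; apply: NNPP => F0; apply: (QS _ QF); exists F; split=> //; apply/eqP.
have [Q [[Qprime IQ Qchain] Qkill]] := IH (ltnW lt_id).
have [Qid Q1 Qpr] := Qprime i (leqnn i).
have IQj u j : (j <= i)%N -> I u -> Q j u.
  elim: j => [|j IHj] le_ji Iu; first exact: IQ.
  by have [QS _] := Qchain j le_ji; apply: QS; apply: IHj => //; apply: ltnW.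
pose z := Ordinal lt_id.
pose J u := exists q a, Q i q /\ u = q + a * tnth y z.
have hJ : is_ideal J.
  have [Q0 QD QM] := Qid; split.
  - by exists 0, 0; rewrite mul0r addr0.
  - move=> u v [q [a [Qq ->]]] [q' [a' [Qq' ->]]]; exists (q + q'), (a + a').
    by rewrite mulrDl addrACA; split=> //; apply: QD.
  - move=> b u [q [a [Qq ->]]]; exists (b * q), (b * a).
    by rewrite mulrDr mulrA; split=> //; apply: QM.
have [|R [Rprime JR RS]] := prime_avoiding hJ (S1 i.+1) (SM i.+1).
  move=> u [q [h [Qq eq_u]]] [F [eq_F /negP]]; apply; apply/eqP.
  have [|||b /Qkill] := @determinant_trick (Q i) F 'X_z h => //.
  - by move=> p; have [c cP] := wI p; exists c; apply: IQj.
  - by rewrite comp_mpolyXU -tnth_nth -eq_F eq_u [_ * h]mulrC addrK.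
  move=> /(congr1 (kill_vars i.+1)); rewrite kill_varsS.
  rewrite {1}/kill_vars rmorphD rmorphM rmorphXn /= -!/(kill_vars _ _).
  rewrite kill_varsX ltnSn mul0r addr0 /kill_vars comp_mpoly0 => /eqP.
  by rewrite expf_eq0 => /andP[_ /eqP].
have QR u : Q i u -> R u by move=> Qu; apply: JR; exists u, 0; rewrite mul0r addr0.
exists (fun j => if (j <= i)%N then Q j else R); split; last first.
  rewrite ltnn => F RF; apply: NNPP => F0; apply: (RS _ RF).
  by exists F; split=> //; apply/eqP.
split.
- by move=> j; rewrite leq_eqVlt => /orP[/eqP->|lt_ji]; [rewrite ltnn|rewrite -ltnS lt_ji; apply: Qprime].
- by move=> p Ip; apply: IQ.
- move=> j; rewrite ltnS => le_ji; rewrite le_ji.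
  case: (ltnP j i) => [lt_ji|ge_ji]; first exact: Qchain.
  have -> : j = i by apply/eqP; rewrite eqn_leq le_ji ge_ji.
  split=> //; exists (tnth y z); split.
    apply: JR; exists 0, 1; rewrite mul1r add0r; split=> //; by case: Qid.
  rewrite (_ : tnth y z = 'X_z \mPo y); last by rewrite comp_mpolyXU -tnth_nth.
  move=> /Qkill/eqP; rewrite kill_varsX ltnn -msize_poly_eq0 msizeX.
  by rewrite eqn0Ngt.
Qed.

End PrimeChain.

(** * Linear forms realising the dimension *)

Lemma mmap_congr_ideal n (R S : comNzRingType) (f : {rmorphism R -> S})
    (J : S -> Prop) (a b : 'I_n -> S) (F : {mpoly R[n]}) :
  is_ideal J -> (forall i, J (a i - b i)) -> J (mmap f a F - mmap f b F).
Proof.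
move=> hJ Jab; have [J0 JD JM] := hJ.
have J_mul u v u' v' : J (u - v) -> J (u' - v') -> J (u * u' - v * v').
  move=> Juv Juv'; have -> : u * u' - v * v' = u * (u' - v') + v' * (u - v) by ring.
  by apply: JD; apply: JM.
rewrite /mmap -sumrB; apply: ideal_sum => // m _; rewrite -mulrBr; apply: JM.
rewrite /mmap1; elim/big_ind2: _ => [|u v u' v' Juv Juv'|i _].
- by rewrite subrr.
- exact: J_mul.
- elim: (m i) => [|j IH]; first by rewrite !expr0 subrr.
  by rewrite !exprS; apply: J_mul.
Qed.

Lemma mmap_scale_homog n (R S : comNzRingType) (f : {rmorphism R -> S})
    (mu : 'I_n -> R) (t : S) c (F : {mpoly R[n]}) : F \is c.-homog ->
  mmap f (fun i => f (mu i) * t) F = f F.@[mu] * t ^+ c.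
Proof.
move=> /dhomogP hF; rewrite mevalE rmorph_sum mulr_suml /mmap big_seq [RHS]big_seq.
apply: eq_bigr => m /hF deg_m; rewrite rmorphM -mulrA; congr (_ * _).
have -> : c = mdeg m by [].
rewrite rmorph_prod mdegE -prodrXr -big_split /mmap1; apply: eq_bigr => i _ /=.
by rewrite rmorphXn exprMn.
Qed.

Section LinearForms.
Variables (n : nat) (k : fieldType).

Lemma homog_prod_sum (R : comNzRingType) (T : Type) (r : seq T)
    (F : T -> {mpoly R[n]}) (b : T -> nat) :
  (forall i, F i \is (b i).-homog) ->
  \prod_(i <- r) F i \is (\sum_(i <- r) b i)%N.-homog.
Proof.
move=> hF; elim: r => [|i r IH]; first by rewrite !big_nil dhomog1.
by rewrite !big_cons; apply: dhomogM.
Qed.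

Lemma pihomog_comp_linear d (y : d.-tuple {mpoly k[n]}) c F : linear_forms y ->
  pihomog mdeg c (F \mPo y) = pihomog mdeg c F \mPo y.
Proof.
move=> liny; have -> : pihomog mdeg c F \mPo y =
    \sum_(m <- msupp F) if mdeg m == c then (F@_m *: 'X_[m]) \mPo y else 0.
  by rewrite /pihomog raddf_sum big_mkcond.
rewrite {1}[F]mpolyE (raddf_sum (comp_mpoly y)) (raddf_sum (pihomog mdeg c)) /=.
apply: eq_bigr => m _; rewrite comp_mpolyZ linearZ /=.
have hm : 'X_[m] \mPo y \is (mdeg m).-homog.
  rewrite comp_mpolyX mdegE; apply: homog_prod_sum => i.
  by have := dhomogMn (m i) (liny i); rewrite mul1n.
have [<-|ne] := eqVneq (mdeg m) c; first by rewrite (pihomog_dE hm) -comp_mpolyZ.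
by rewrite (pihomog_ne0 ne hm) scaler0.
Qed.

Variable I : {mpoly k[n]} -> Prop.
Hypotheses (hk : infinite_type k) (hI : homogeneous_ideal I) (I1 : is_proper I).

Let idI : is_ideal I. Proof. by case: hI. Qed.

Definition covered_by d :=
  exists y : d.-tuple {mpoly k[n]}, linear_forms y /\ exists e, covers I y e.

(** A relation [F(y)] in [I], where [F] may be taken homogeneous of some degree
    [c], makes one form superfluous: choose a point [lam] with [F(lam) <> 0].
    Modulo [I] and the forms [y_i - (lam_i / lam_j) y_j] all the [y_i] become
    multiples of [y_j], and the relation becomes [F(lam) (y_j / lam_j) ^ c = 0].
    So [y_j ^ c] vanishes, and with it everything of degree [e * c], each factor
    of degree [e] being a multiple of [y_j]. *)
Lemma covered_by_fewer d (y : d.-tuple {mpoly k[n]}) e F :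
  linear_forms y -> covers I y e -> F != 0 -> I (F \mPo y) ->
  exists d', d = d'.+1 /\ covered_by d'.
Proof.
move=> liny cov F0 IF.
wlog [c hF] : F F0 IF / exists c, F \is c.-homog.
  move=> H; pose c := mdeg (mlead F).
  apply: (H (pihomog mdeg c F)).
  - apply/eqP => /(congr1 (mcoeff (mlead F))); rewrite mcoeff0 mcoeff_pihomog eqxx.
    by move/eqP; rewrite mleadc_eq0 (negbTE F0).
  - by rewrite -pihomog_comp_linear //; case: hI => _; apply.
  - by exists c; apply: pihomogP.
have [lam Flam] := infinite_mpoly_nonroot hk F0.
have [j lamj] : exists j, lam j != 0.
  apply/existsP; apply: contraNT Flam; rewrite negb_exists => /forallP lam0.
  have -> : F.@[lam] = F.@[fun i => lam i * 0].
    by apply: meval_eq => i; rewrite mulr0; apply/eqP; rewrite -[_ == _]negbK.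
  rewrite /meval (mmap_scale_homog (idfun : {rmorphism k -> k}) lam 0 hF) /=.
  case: c hF => [|c] hF; last by rewrite expr0n mulr0.
  case: I1; move: IF F0; have -> : F = (F@_0)%:MP.
    have [->|F0] := eqVneq F 0; first by rewrite mcoeff0 mpolyC0.
    by apply: msize1_polyC; rewrite (msizeS_homog hF F0).
  rewrite comp_mpolyC mpolyC_eq0 => IF F0.
  by rewrite -mpolyC1 -(mulVf F0) mpolyCM; case: idI => _ _; apply.
case: d y liny cov F F0 IF hF lam Flam j lamj => [|d] y liny cov F F0 IF hF lam Flam j lamj.
  by case: j {lamj}.
exists d; split=> //.
pose mu i := lam i / lam j.
pose y' := [tuple tnth y (lift j i) - mu (lift j i) *: tnth y j | i < d].
have hJ := reduction_ideal I y'; have [J0 JD JM] := hJ.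
have IJ u : I u -> reduction I y' u by move=> Iu; apply: mem_ideal_gen; left.
have Jy i : reduction I y' (tnth y i - (mu i)%:MP * tnth y j).
  case: (unliftP j i) => [i' ->|->]; last by rewrite /mu divff // mpolyC1 mul1r subrr.
  rewrite mul_mpolyC; apply: mem_ideal_gen; right; apply/tnthP; exists i'.
  by rewrite tnth_mktuple.
have Jpow : reduction I y' (tnth y j ^+ c).
  have := mmap_congr_ideal (@mpolyC n k) F hJ Jy.
  rewrite -/(comp_mpoly y F) (mmap_scale_homog (@mpolyC n k) mu (tnth y j) hF) => JF.
  have {}JF : reduction I y' ((F.@[mu])%:MP * tnth y j ^+ c).
    by rewrite -[_ * _](subKr (F \mPo y)); apply: idealB => //; apply: IJ.
  have mu0 : F.@[mu] != 0.
    have := mmap_scale_homog (idfun : {rmorphism k -> k}) lam (lam j)^-1 hF.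
    by rewrite -[mmap _ _ _]/(F.@[mu]) => ->; rewrite mulf_neq0 // expf_neq0 // invr_neq0.
  by rewrite -[tnth y j ^+ c]mul1r -mpolyC1 -(mulVf mu0) mpolyCM -mulrA; apply: JM.
exists y'; split.
  move=> i; rewrite tnth_mktuple; apply: rpredB; first exact: liny.
  by apply: rpredZ; apply: liny.
exists (e * c)%N => p; apply: homog_in_ideal => // m deg_m.
suff [a Ja] : exists a, reduction I y' ('X_[m] - a * tnth y j ^+ c).
  by apply: (idealBK hJ _ Ja); apply: JM.
elim: c {hF Jpow} m deg_m => [|c IH] m deg_m.
  by exists 'X_[m]; rewrite expr0 mulr1 subrr.
have [|m1 [m2 [eq_m deg1]]] := @mnm_split n m e; first by rewrite deg_m leq_pmulr.
have [|a Ja] := IH m2.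
  by apply/eqP; rewrite -(eqn_add2l (mdeg m1)) -mdegD -eq_m deg_m deg1 mulnS.
have /(reductionP hI)[q [b [Iq eq_m1]]] : reduction I y 'X_[m1].
  by apply: cov; rewrite dhomogX; apply/eqP.
pose b' := \sum_(i < d.+1) b i * (mu i)%:MP.
have Jb : reduction I y' ('X_[m1] - b' * tnth y j).
  rewrite eq_m1 -addrA; apply: (JD); first exact: IJ.
  rewrite /b' mulr_suml -sumrB; apply: ideal_sum => // i _.
  by rewrite -mulrA -mulrBr; apply: JM.
exists (b' * a); rewrite eq_m mpolyXD.
have -> : 'X_[m1] * 'X_[m2] - b' * a * tnth y j ^+ c.+1 =
  'X_[m2] * ('X_[m1] - b' * tnth y j) +
  (b' * tnth y j) * ('X_[m2] - a * tnth y j ^+ c) by rewrite exprS; ring.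
by apply: JD; apply: JM.
Qed.

Lemma covered_by_vars : covered_by n.
Proof.
exists [tuple 'X_i | i < n]; split.
  by move=> i; rewrite tnth_mktuple dhomogX; apply/eqP/mdeg1.
exists 1%N => p; apply: homog_in_ideal; first exact: reduction_ideal.
move=> m /eqP/mdeg1P[i /eqP->]; apply: mem_ideal_gen; right.
by apply/tnthP; exists i; rewrite tnth_mktuple.
Qed.

Variables (D : nat) (dimI : krull_dim I D).

(** A prime chain of length [D] provides [D] algebraically independent elements,
    too many for a finite module over fewer than [D] forms. *)
Lemma dim_le_covered d : covered_by d -> (D <= d)%N.
Proof.
move=> [y [liny [e cov]]]; have [[Q QP] _] := dimI.
have [Qprime IQ Qchain] := QP.
have [|f findep] := @chain_alg_indep n k D Q; first by split.
have [l [w wgen]] := covers_finite hI liny cov.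
by apply: alg_indep_le idI _ wgen => F /IQ/findep.
Qed.

Lemma covering_dim_injective (y : D.-tuple {mpoly k[n]}) e F :
  linear_forms y -> covers I y e -> I (F \mPo y) -> F = 0.
Proof.
move=> liny cov IF; apply/eqP/negPn/negP => F0.
have [d [eqD /dim_le_covered]] := covered_by_fewer liny cov F0 IF.
by rewrite eqD ltnn.
Qed.

(** Start from the variables and drop superfluous forms. When none is left to
    drop, the forms are algebraically independent, so their number is also at
    most [D]. *)
Lemma covered_by_dim : covered_by D.
Proof.
suff H d : covered_by d -> covered_by D by apply: H covered_by_vars.
elim: d => [|d IH] covd; have := dim_le_covered covd.
  by rewrite leqn0 => /eqP->.
have [y [liny [e cov]]] := covd.
have [inj|Ninj] := classic (forall F, I (F \mPo y) -> F = 0); last first.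
  move=> _; apply: IH; have [F NF] := not_all_ex_not _ _ Ninj.
  have [IF F0] := imply_to_and _ _ NF.
  by have [|d' [[<-]]] := covered_by_fewer liny cov _ IF; first exact/eqP.
have [l [w wgen]] := covers_finite hI liny cov.
have [|Q QP] := @alg_indep_chain _ _ _ y l w I idI _ inj.
  by move=> p; have [c [_ Ic]] := wgen p; exists c.
have [_ /(_ d.+1) leD] := dimI; have {}leD := leD (ex_intro _ Q QP) => geD.
by rewrite (_ : D = d.+1) //; apply/eqP; rewrite eqn_leq leD geD.
Qed.

(** Only the injectivity is not formal here: a relation between the forms would
    make one of them superfluous, and fewer than [D] forms cannot do. *)
Lemma covering_noether_normalisation (y : D.-tuple {mpoly k[n]}) e :
  linear_forms y -> covers I y e -> noether_normalisation I y.
Proof.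
move=> liny cov; split=> // [F|]; first exact: covering_dim_injective cov.
have [l [w wgen]] := covers_finite hI liny cov; exists l, w => p.
by have [c [_ Ic]] := wgen p; exists c.
Qed.

End LinearForms.

(** * Specialising the coefficients of linear forms *)

Section Specialization.
Variables (n D d : nat) (k : fieldType) (I : {mpoly k[n]} -> Prop).
Hypothesis hI : homogeneous_ideal I.

Let idI : is_ideal I. Proof. by case: hI. Qed.

Definition lin_form (R : comNzRingType) (Y : 'M[R]_(D, n)) i : {mpoly R[n]} :=
  \sum_j Y i j *: 'X_j.

Definition ext_gens (R : comNzRingType) (iota : k -> R) (Y : 'M[R]_(D, n)) q :=
  (exists2 g, I g & q = map_mpoly iota g) \/ exists i, q = lin_form Y i.

(** The analogue of [covers] for forms with coefficients in an extension of [k]. *)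
Definition covers_over (R : comNzRingType) (iota : k -> R) (Y : 'M[R]_(D, n)) :=
  forall p : {mpoly R[n]}, p \is d.-homog -> ideal_gen (ext_gens iota Y) p.

Lemma lin_form_homog (R : comNzRingType) (Y : 'M[R]_(D, n)) i :
  lin_form Y i \is 1.-homog.
Proof.
by apply: rpred_sum => j _; apply: rpredZ; rewrite dhomogX; apply/eqP/mdeg1.
Qed.

Lemma ext_ideal_homogeneous (R : comNzRingType) (iota : {rmorphism k -> R})
    (Y : 'M[R]_(D, n)) p c :
  ideal_gen (ext_gens iota Y) p -> ideal_gen (ext_gens iota Y) (pihomog mdeg c p).
Proof.
apply: ideal_gen_homogeneous => {c}p c [[g Ig ->]|[i ->]].
  left; exists (pihomog mdeg c g); first by case: hI => _; apply.
  exact: map_mpoly_pihomog.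
have hY := lin_form_homog Y i; have [->|ne] := eqVneq c 1%N.
  by right; exists i; apply: pihomog_dE.
left; exists 0; first by case: idI.
by rewrite raddf0 (pihomog_ne0 _ hY) // eq_sym.
Qed.

(* The elements of the family whose linear span is the ideal: the elements of
   [I], and the monomial multiples of the linear forms. *)
Let gen : eqType := ({mpoly k[n]} + 'X_{1..n} * 'I_D)%type.

Let gen_ok (x : gen) := if x is inl q then I q else True.

Let gen_val (R : comNzRingType) (iota : k -> R) (Y : 'M[R]_(D, n)) (x : gen) :=
  match x with
  | inl q => map_mpoly iota q
  | inr (m, i) => 'X_[m] * lin_form Y i
  end.

Let gen_val_mem (R : comNzRingType) (iota : k -> R) (Y : 'M[R]_(D, n)) x :
  gen_ok x -> ideal_gen (ext_gens iota Y) (gen_val iota Y x).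
Proof.
case: x => [q Iq|[m i] _] /=; first by apply: mem_ideal_gen; left; exists q.
have [_ _] := ideal_gen_ideal (ext_gens iota Y); apply; apply: mem_ideal_gen.
by right; exists i.
Qed.

Let gen_span (R : comNzRingType) (iota : {rmorphism k -> R}) (Y : 'M[R]_(D, n)) p :
  ideal_gen (ext_gens iota Y) p ->
  exists s : seq (R * gen), (forall u, u \in s -> gen_ok u.2) /\
    p = \sum_(u <- s) u.1 *: gen_val iota Y u.2.
Proof.
pose W p := exists s : seq (R * gen), (forall u, u \in s -> gen_ok u.2) /\
    p = \sum_(u <- s) u.1 *: gen_val iota Y u.2.
have W0 : W 0 by exists [::]; rewrite big_nil.
have WD u v : W u -> W v -> W (u + v).
  move=> [s [Ss ->]] [t [St ->]]; exists (s ++ t); rewrite big_cat; split=> // x.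
  by rewrite mem_cat => /orP[/Ss|/St].
have WMX c m u : W u -> W (c *: 'X_[m] * u).
  move=> [s [Ss ->]].
  pose shift (x : gen) : gen := match x with
    | inl q => inl ('X_[m] * q)
    | inr (m', i) => inr ((m + m')%MM, i) end.
  exists [seq (c * x.1, shift x.2) | x <- s]; split=> [x /mapP[[a g] /Ss /= + ->]|].
    by case: g => [q|[]] //= Iq; case: idI => _ _; apply.
  rewrite big_map mulr_sumr; apply: eq_bigr => -[a g] _ /=.
  rewrite -scalerAr -scalerAl scalerA [a * c]mulrC; congr (_ *: _).
  by case: g => [q|[m' i]] /=; rewrite ?rmorphM /= ?map_mpolyX // mpolyXD mulrA.
apply: (@ideal_gen_min _ _ W) => [|q].
  split=> // a u Wu; rewrite [a]mpolyE mulr_suml.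
  by apply: big_ind => // m _; apply: WMX.
case=> [[g Ig ->]|[i ->]].
  exists [:: (1, inl g)]; rewrite big_seq1 scale1r; split=> // x.
  by rewrite inE => /eqP->.
exists [:: (1, inr (0%MM, i))]; rewrite big_seq1 scale1r /= mpolyX0 mul1r; split=> // x.
by rewrite inE => /eqP->.
Qed.

Let gen_val_map (R S : comNzRingType) (iota : {rmorphism k -> R})
    (g : {rmorphism R -> S}) (Y : 'M[R]_(D, n)) x :
  map_mpoly g (gen_val iota Y x) = gen_val (g \o iota) (map_mx g Y) x.
Proof.
case: x => [q|[m i]] /=.
  by apply/mpolyP => m; rewrite !mcoeff_map_mpoly.
rewrite rmorphM /= map_mpolyX raddf_sum; congr (_ * _); apply: eq_bigr => j _ /=.
by rewrite map_mpolyZ map_mpolyX mxE.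
Qed.

Let mons := {m : 'X_{1..n < d.+1} | mdeg m == d}.
Let mon (i : 'I_#|{: mons}|) : 'X_{1..n} := val (val (enum_val i)).

Let deg_mon i : mdeg (mon i) = d. Proof. exact/eqP/(valP (enum_val i)). Qed.

Let mon_onto m : mdeg m = d -> exists i, m = mon i.
Proof.
move=> deg_m; have lt_md : (mdeg m < d.+1)%N by rewrite deg_m.
have deg_m' : mdeg (BMultinom lt_md) == d by apply/eqP.
by exists (enum_rank (Sub (BMultinom lt_md) deg_m' : mons)); rewrite /mon enum_rankK.
Qed.

Let mon_inj : injective mon.
Proof. by move=> i j /val_inj/val_inj/enum_val_inj. Qed.

(** Openness: if the ideal contains everything of degree [d] after one
    specialisation of the coefficients, then finitely many of its elements
    witness this through the determinant [delta] of their coefficient matrix,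
    and they do so for every specialisation where [delta] does not vanish. *)
Lemma covers_over_open (A : comNzRingType) (F : fieldType)
    (iota : {rmorphism k -> A}) (g : {rmorphism A -> F}) (Y : 'M[A]_(D, n)) :
  covers_over (g \o iota) (map_mx g Y) ->
  exists delta, g delta != 0 /\
    forall (F' : fieldType) (g' : {rmorphism A -> F'}), g' delta != 0 ->
      covers_over (g' \o iota) (map_mx g' Y).
Proof.
move=> cov.
pose vec (R : comNzRingType) (p : {mpoly R[n]}) := \row_j p@_(mon j).
have homX j : ('X_[mon j] : {mpoly F[n]}) \is d.-homog.
  by rewrite dhomogX; apply/eqP/deg_mon.
have [s sP] := fin_all_exists (fun j => gen_span (cov _ (homX j))).
(* Finitely many generators span all monomials of degree [d]; among them a
   square invertible selection can be made. *)
pose L := flatten [seq [seq u.2 | u <- s j] | j <- enum 'I_#|{: mons}|].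
have memL j u : u \in s j -> u.2 \in L.
  move=> uj; apply/flattenP; exists [seq u.2 | u <- s j]; last exact: map_f.
  by apply: map_f; rewrite mem_enum.
have okL x : x \in L -> gen_ok x.
  case/flattenP=> _ /mapP[j _ ->] /mapP[u uj ->]; exact: (sP j).1.
pose B := \matrix_(i < size L) vec F (gen_val (g \o iota) (map_mx g Y) (tnth (in_tuple L) i)).
have fullB : row_full B.
  rewrite -sub1mx; apply/row_subP => j.
  have -> : row j 1%:M = vec F 'X_[mon j].
    by apply/rowP => j'; rewrite !mxE mcoeffX (inj_eq mon_inj).
  have [_ ->] := sP j.
  have -> : vec F (\sum_(u <- s j) u.1 *: gen_val (g \o iota) (map_mx g Y) u.2) =
      \sum_(u <- s j) u.1 *: vec F (gen_val (g \o iota) (map_mx g Y) u.2).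
    apply/rowP => j'; rewrite !mxE raddf_sum summxE; apply: eq_bigr => u _.
    by rewrite !mxE /= mcoeffZ.
  rewrite big_seq; apply: summx_sub => u /memL/(tnthP (in_tuple L))[i eq_u].
  apply: scalemx_sub; rewrite eq_u.
  by have := row_sub i B; rewrite rowK.
pose x i := tnth (in_tuple L) (fullrankfun fullB i).
have okx i : gen_ok (x i) by apply: okL; apply: mem_tnth.
pose M : 'M[A]_#|{: mons}| := \matrix_(i, j) (gen_val iota Y (x i))@_(mon j).
have mapM (R : comNzRingType) (h : {rmorphism A -> R}) i j :
    map_mx h M i j = (gen_val (h \o iota) (map_mx h Y) (x i))@_(mon j).
  by rewrite -gen_val_map mcoeff_map_mpoly !mxE.
exists (\det M); split.
  rewrite -det_map_mx -unitfE -/(_ \in unitmx).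
  have -> : map_mx g M = rowsub (fullrankfun fullB) B.
    by apply/matrixP => i j; rewrite mapM !mxE.
  exact: fullrowsub_unit.
move=> F' g' detM; have unitM : map_mx g' M \in unitmx by rewrite unitmxE det_map_mx unitfE.
move=> p; apply: homog_in_ideal => [|m /mon_onto[j ->]]; first exact: ideal_gen_ideal.
pose v i := gen_val (g' \o iota) (map_mx g' Y) (x i).
have -> : 'X_[mon j] = \sum_i (invmx (map_mx g' M) j i)%:MP * pihomog mdeg d (v i).
  apply/mpolyP => {}m; rewrite raddf_sum /= mcoeffX.
  under eq_bigr => i _ do rewrite mcoeffCM mcoeff_pihomog.
  have [deg_m|ne] := eqVneq (mdeg m) d; last first.
    rewrite big1 => [|i _]; last by rewrite mulr0.
    have /negbTE-> // : mon j != m by apply: contra_neq ne => <-; exact: deg_mon.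
  have [j' ->] := mon_onto deg_m; rewrite (inj_eq mon_inj).
  have := congr1 (fun N : 'M_#|{: mons}| => N j j') (mulVmx unitM).
  by rewrite !mxE => <-; apply: eq_bigr => i _; rewrite mapM.
apply: ideal_sum => [|i _]; first exact: ideal_gen_ideal.
have [_ _] := ideal_gen_ideal (ext_gens (g' \o iota) (map_mx g' Y)); apply.
exact/ext_ideal_homogeneous/gen_val_mem.
Qed.

End Specialization.

(** * Generic linear forms and elimination *)

Section CoversOver.
Variables (n D d : nat) (k : fieldType) (I : {mpoly k[n]} -> Prop).

Lemma eq_covers_over (R : comNzRingType) (iota iota' : k -> R) (Y : 'M[R]_(D, n)) :
  iota =1 iota' -> covers_over d I iota Y -> covers_over d I iota' Y.
Proof.
move=> eq_iota cov p /cov; apply: ideal_gen_mono => {}p [[g Ig ->]|[i ->]].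
  apply: mem_ideal_gen; left; exists g => //.
  by apply: eq_bigr => m _; rewrite /= eq_iota.
by apply: mem_ideal_gen; right; exists i.
Qed.

Lemma covers_over_mulmx (R : comNzRingType) (iota : k -> R) (M : 'M[R]_D)
    (Y : 'M[R]_(D, n)) : covers_over d I iota (M *m Y) -> covers_over d I iota Y.
Proof.
move=> cov p /cov; apply: ideal_gen_mono => {}p [[g Ig ->]|[i ->]].
  by apply: mem_ideal_gen; left; exists g.
have -> : lin_form (M *m Y) i = \sum_j (M i j)%:MP * lin_form Y j.
  rewrite /lin_form; under [RHS]eq_bigr => j _ do rewrite mulr_sumr.
  rewrite exchange_big; apply: eq_bigr => j _ /=; rewrite mxE scaler_suml.
  by apply: eq_bigr => l _; rewrite mul_mpolyC scalerA.
apply: ideal_sum => [|j _]; first exact: ideal_gen_ideal.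
have [_ _] := ideal_gen_ideal (ext_gens I iota Y); apply; apply: mem_ideal_gen.
by right; exists j.
Qed.

Lemma map_mpoly_idfun (g : {mpoly k[n]}) : map_mpoly idfun g = g.
Proof. by apply/mpolyP => m; rewrite (mcoeff_map_mpoly (idfun : {rmorphism k -> k})). Qed.

Lemma covers_coefs (y : D.-tuple {mpoly k[n]}) : linear_forms y -> covers I y d ->
  covers_over d I idfun (\matrix_(i, j) (tnth y i)@_U_(j)).
Proof.
move=> liny cov p /cov; apply: ideal_gen_mono => {}p [Ip|/tnthP[i ->]].
  by apply: mem_ideal_gen; left; exists p; rewrite ?map_mpoly_idfun.
apply: mem_ideal_gen; right; exists i; apply/mpolyP => m.
rewrite raddf_sum /=; under eq_bigr => j _ do rewrite mxE mcoeffZ mcoeffX.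
have [/eqP/mdeg1P[j /eqP->]|ne] := eqVneq (mdeg m) 1%N.
  rewrite (bigD1 j) //= eqxx mulr1 big1 ?addr0 // => j' /negbTE ne.
  by rewrite eq_mnm1 ne mulr0.
rewrite (dhomog_nemf_coeff (liny i) ne) big1 // => j _.
have [eq_m|_] := eqVneq U_(j)%MM m; last by rewrite mulr0.
by rewrite -eq_m mdeg1 in ne.
Qed.

Lemma covers_lin_forms (Y : 'M[k]_(D, n)) : covers_over d I idfun Y ->
  covers I [tuple lin_form Y i | i < D] d.
Proof.
move=> cov p /cov; apply: ideal_gen_mono => {}p [[g Ig ->]|[i ->]].
  by apply: mem_ideal_gen; left; rewrite map_mpoly_idfun.
apply: mem_ideal_gen; right; apply/tnthP; exists i.
by rewrite tnth_mktuple.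
Qed.

End CoversOver.

Section Generic.
Variables (e D d : nat) (k : fieldType) (I : {mpoly k[e + D]} -> Prop).
Hypotheses (hk : infinite_type k) (hI : homogeneous_ideal I).

(** Moving along the line [Y + t (0 | 1)], the last block becomes invertible
    while the covering property survives, both for all but finitely many [t];
    row operations then turn the last block into the identity. *)
Lemma covers_normal_form (Y : 'M[k]_(D, e + D)) : covers_over d I idfun Y ->
  exists A : 'M[k]_(D, e), covers_over d I idfun (row_mx A 1%:M).
Proof.
move=> cov.
pose Yt : 'M[{poly k}]_(D, e + D) :=
  map_mx polyC Y + 'X *: map_mx polyC (row_mx 0 1%:M).
have YtE t : map_mx (horner_eval t) Yt = Y + t *: row_mx 0 1%:M.
  by apply/matrixP => i j; rewrite !mxE /horner_eval !hornerE.
have horner_evalK t : (horner_eval t \o polyC : k -> k) =1 idfun.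
  by move=> c; rewrite /= /horner_eval hornerC.
have [|delta [delta0 open]] :=
    @covers_over_open _ _ d _ _ hI {poly k} k polyC (horner_eval 0) Yt.
  by rewrite YtE scale0r addr0; apply: eq_covers_over cov => c; rewrite horner_evalK.
pose chi := char_poly (- rsubmx Y).
have [t] : exists t, (delta * chi).[t] != 0.
  apply: infinite_nonroot => //; apply: mulf_neq0; last exact/monic_neq0/char_poly_monic.
  by apply: contra_neq delta0 => ->; rewrite raddf0.
rewrite hornerM mulf_eq0 negb_or => /andP[deltat chit].
pose Z := Y + t *: row_mx 0 1%:M.
have unitZ : rsubmx Z \in unitmx.
  rewrite unitmxE unitfE; apply: contra_neq chit => <-.
  rewrite -[LHS]/(horner_eval t chi) -det_map_mx; congr (\det _).
  apply/matrixP => i j; rewrite !mxE /= (unsplitK (inr j : 'I_e + 'I_D)) !mxE.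
  by rewrite /horner_eval !hornerE; case: eqP => _; rewrite ?hornerE //=; ring.
have covZ : covers_over d I idfun Z.
  by apply: (eq_covers_over (horner_evalK t)); rewrite /Z -YtE; apply: open.
exists (invmx (rsubmx Z) *m lsubmx Z); apply: (@covers_over_mulmx _ _ _ _ _ _ _ (rsubmx Z)).
by rewrite mul_mx_row mulmx1 mulKVmx // hsubmxK.
Qed.

Local Notation K := (param_field k e D).
Local Notation coefs := {mpoly k[D * e]}.

(** The embedding of [k] underlying [const_embed], as a ring morphism. *)
Definition to_param : {rmorphism k -> K} := @tofrac coefs \o @mpolyC (D * e) k.

Definition generic_coefs : 'M[coefs]_(D, e) := \matrix_(i, j) 'X_(mxvec_index i j).

Definition param_forms : 'M[K]_(D, e + D) :=
  map_mx (@tofrac coefs) (row_mx generic_coefs 1%:M).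

(** The determinant found over [k] is nonzero as a polynomial in the parameters,
    hence nonzero in their fraction field. *)
Lemma covers_generic (A : 'M[k]_(D, e)) :
  covers_over d I idfun (row_mx A 1%:M) -> covers_over d I to_param param_forms.
Proof.
move=> cov; pose v s := mxvec A 0 s.
have [|delta [delta0 open]] := @covers_over_open _ _ d _ _ hI coefs k
    (@mpolyC (D * e) k) (meval v) (row_mx generic_coefs 1%:M).
  have -> : map_mx (meval v) (row_mx generic_coefs 1%:M) = row_mx A 1%:M.
    rewrite map_row_mx map_mx1; congr row_mx.
    by apply/matrixP => i j; rewrite !mxE mevalXU /v mxvecE.
  by apply: eq_covers_over cov => c; rewrite /= mevalC.
apply: open; rewrite tofrac_eq0.
by apply: contra_neq delta0 => ->; rewrite raddf0.
Qed.

(** Over an infinite field the determinant found generically is nonzero at some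
    point. *)
Lemma covers_specialize : covers_over d I to_param param_forms ->
  exists A : 'M[k]_(D, e), covers_over d I idfun (row_mx A 1%:M).
Proof.
move=> cov; have [delta [delta0 open]] := covers_over_open hI cov.
have [|v deltav] := @infinite_mpoly_nonroot k hk _ delta.
  by rewrite -tofrac_eq0.
exists (\matrix_(i, j) v (mxvec_index i j)).
have -> : row_mx (\matrix_(i, j) v (mxvec_index i j)) 1%:M =
    map_mx (meval v) (row_mx generic_coefs 1%:M).
  rewrite map_row_mx map_mx1; congr row_mx.
  by apply/matrixP => i j; rewrite !mxE mevalXU.
by apply: eq_covers_over (open _ _ deltav) => c; rewrite /= mevalC.
Qed.

End Generic.

Section Elimination.
Variables (e D : nat) (k K : fieldType) (I : {mpoly k[e + D]} -> Prop).
Variables (iota : {rmorphism k -> K}) (A : 'M[K]_(D, e)).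
Hypothesis hI : homogeneous_ideal I.

(** The substitution solving the forms [x_(e+i) + sum_j A_ij x_j] for [x_(e+i)].
    It is studied over an arbitrary extension [K] of [k]; the parameter field is
    one instance. *)
Definition elim_var (v : 'I_(e + D)) : {mpoly K[e]} :=
  match split v with
  | inl j => 'X_j
  | inr i => - \sum_(j < e) A i j *: 'X_j
  end.

Definition elim_forms : (e + D).-tuple {mpoly K[e]} := [tuple elim_var v | v < e + D].

Definition elim_image : {mpoly K[e]} -> Prop :=
  ideal_gen (fun p => exists2 g, I g & p = map_mpoly iota g \mPo elim_forms).

Lemma elim_var_lshift (j : 'I_e) : elim_var (lshift D j) = 'X_j.
Proof. by rewrite /elim_var (unsplitK (inl j : 'I_e + 'I_D)). Qed.

Lemma elim_var_rshift (i : 'I_D) :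
  elim_var (rshift e i) = - \sum_(j < e) A i j *: 'X_j.
Proof. by rewrite /elim_var (unsplitK (inr i : 'I_e + 'I_D)). Qed.

Lemma homogX (n : nat) (j : 'I_n) : 'X_j \is [in K[n], 1.-homog].
Proof. by rewrite dhomogX; apply/eqP/mdeg1. Qed.

Lemma elim_forms_linear : linear_forms elim_forms.
Proof.
move=> v; rewrite tnth_mktuple.
case: (split_ordP v) => [j ->|i ->]; first by rewrite elim_var_lshift homogX.
rewrite elim_var_rshift rpredN; apply: rpred_sum => j _; apply: rpredZ.
exact: homogX.
Qed.

Definition embed_vars : e.-tuple {mpoly K[e + D]} := [tuple 'X_(lshift D j) | j < e].

Lemma embed_vars_linear : linear_forms embed_vars.
Proof. by move=> j; rewrite tnth_mktuple homogX. Qed.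

Lemma comp_linear_homog n m (y : n.-tuple {mpoly K[m]}) d p :
  linear_forms y -> p \is d.-homog -> p \mPo y \is d.-homog.
Proof. by move=> liny hp; rewrite homog_piE pihomog_comp_linear // (pihomog_dE hp). Qed.

Lemma elim_image_homogeneous p d : elim_image p -> elim_image (pihomog mdeg d p).
Proof.
apply: ideal_gen_homogeneous => {}p {}d [g Ig ->].
exists (pihomog mdeg d g); first by case: hI => _; apply.
by rewrite pihomog_comp_linear ?map_mpoly_pihomog //; apply: elim_forms_linear.
Qed.

Lemma elim_ideal_gen (S : {mpoly k[e + D]} -> Prop) f : ideal_gen S f ->
  ideal_gen (fun p => exists2 g, S g & p = map_mpoly iota g \mPo elim_forms)
    (map_mpoly iota f \mPo elim_forms).
Proof.
move=> [s [Ss ->]].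
rewrite (raddf_sum (map_mpoly iota)) (raddf_sum (comp_mpoly elim_forms)).
apply: ideal_sum_seq => [|[a u] /Ss /= Su]; first exact: ideal_gen_ideal.
rewrite !rmorphM /=; case: (ideal_gen_ideal (fun p => exists2 g, S g &
  p = map_mpoly iota g \mPo elim_forms)) => _ _; apply.
by apply: mem_ideal_gen; exists u.
Qed.

Lemma comp_embedK p : (p \mPo embed_vars) \mPo elim_forms = p.
Proof.
rewrite -[RHS]comp_mpoly_id /comp_mpoly mmap_comp; apply: eq_bigr => m _.
congr (_ * _); apply: mmap1_eq => j; rewrite !tnth_mktuple.
by rewrite mmapX mmap1U tnth_mktuple elim_var_lshift.
Qed.

Lemma lin_form_row_mx1 i :
  lin_form (row_mx A 1%:M) i = \sum_(j < e) A i j *: 'X_(lshift D j) + 'X_(rshift e i).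
Proof.
rewrite /lin_form big_split_ord /=; congr (_ + _).
  by apply: eq_bigr => j _; rewrite row_mxEl.
rewrite (bigD1 i) //= row_mxEr mxE eqxx scale1r big1 ?addr0 // => i' /negbTE ne.
by rewrite row_mxEr mxE eq_sym ne scale0r.
Qed.

Lemma lin_form_elim i : lin_form (row_mx A 1%:M) i \mPo elim_forms = 0.
Proof.
rewrite lin_form_row_mx1 raddfD raddf_sum /= comp_mpolyXU -tnth_nth tnth_mktuple.
rewrite elim_var_rshift; apply/eqP; rewrite subr_eq0; apply/eqP.
apply: eq_bigr => j _.
by rewrite comp_mpolyZ comp_mpolyXU -tnth_nth tnth_mktuple elim_var_lshift.
Qed.

(** Modulo the linear forms, [x_(e+i) = - sum_j A_ij x_j], so the substitution
    acts as the identity there: the quotient by [I] and the forms is isomorphic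
    to the quotient by [elim_image]. *)
Lemma covers_elim_image d :
  covers_over d I iota (row_mx A 1%:M) <-> (forall p, p \is d.-homog -> elim_image p).
Proof.
pose L := ext_gens I iota (row_mx A 1%:M).
have idL := ideal_gen_ideal L.
have idI' : is_ideal elim_image by apply: ideal_gen_ideal.
split=> cov p hp.
  have [s [Ls eq_p]] := cov _ (comp_linear_homog embed_vars_linear hp).
  rewrite -[p]comp_embedK eq_p rmorph_sum.
  apply: ideal_sum_seq => // -[a u] /Ls Lu; rewrite rmorphM /=.
  case: (idI') => I'0 _; apply; case: Lu => [[g Ig /= ->]|[i /= ->]].
    by apply: mem_ideal_gen; exists g.
  by rewrite lin_form_elim.
pose back q := (q \mPo elim_forms) \mPo embed_vars.
have backE q : ideal_gen L (back q - q).
  rewrite /back {1}/comp_mpoly mmap_comp -[X in _ - X]comp_mpoly_id.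
  apply: mmap_congr_ideal => // v; rewrite !tnth_mktuple.
  case: (split_ordP v) => [j ->|i ->].
    rewrite elim_var_lshift mmapX mmap1U tnth_mktuple subrr.
    by case: idL.
  rewrite elim_var_rshift raddfN -opprD; apply: idealN => //.
  apply: mem_ideal_gen; right; exists i; rewrite lin_form_row_mx1; congr (_ + _).
  rewrite raddf_sum; apply: eq_bigr => j _ /=.
  by rewrite mmapZ mmapX mmap1U tnth_mktuple mul_mpolyC.
have Lp : ideal_gen L (back p).
  have [s [Is eq_p]] := cov _ (comp_linear_homog elim_forms_linear hp).
  rewrite /back eq_p rmorph_sum.
  apply: ideal_sum_seq => // -[a u] /Is /= [g Ig ->]; rewrite rmorphM.
  case: (idL) => _ _; apply.
  apply: (@idealBK _ _ _ (map_mpoly iota g)) => //; last exact: backE.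
  by apply: mem_ideal_gen; left; exists g.
by rewrite -[p](subKr (back p)); apply: idealB.
Qed.

End Elimination.

Section GenericIdeal.
Variables (e D : nat) (k : fieldType) (I : {mpoly k[e + D]} -> Prop).

Local Notation K := (param_field k e D).

Definition param_mx : 'M[K]_(D, e) := \matrix_(i, j) param k i j.

Lemma param_formsE : param_forms e D k = row_mx param_mx 1%:M.
Proof.
rewrite /param_forms map_row_mx map_mx1; congr row_mx.
by apply/matrixP => i j; rewrite !mxE.
Qed.

Lemma generic_substE g :
  @generic_subst k (e + D) e D g = map_mpoly (to_param e D k) g \mPo elim_forms param_mx.
Proof.
rewrite /map_mpoly [in RHS]/mmap rmorph_sum; apply: eq_bigr => m _.
rewrite rmorphM /= comp_mpolyC mmap1_id comp_mpolyX; congr (_ * _).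
apply: eq_bigr => v _; rewrite tnth_mktuple; congr (_ ^+ _).
case: (split_ordP v) => [j ->|i ->].
  by rewrite elim_var_lshift /subst_var /= valK.
rewrite elim_var_rshift /subst_var insubF /=; last by rewrite ltnNge leq_addr.
by rewrite addKn valK; congr (- _); apply: eq_bigr => j _; rewrite mxE.
Qed.

End GenericIdeal.

(** * The degree reverse lexicographic order *)

Section DegRevLex.
Variable n : nat.
Implicit Types (m t : 'X_{1..n}).

Lemma drl_ltP m1 m2 : reflect
  ((mdeg m1 < mdeg m2)%N \/ mdeg m1 = mdeg m2 /\
    exists i : 'I_n, (m2 i < m1 i)%N /\ forall j : 'I_n, (i < j)%N -> m1 j = m2 j)
  (drl_lt m1 m2).
Proof.
apply: (iffP orP) => [[lt12|/andP[/eqP eq12 /existsP[i /andP[lti /forallP eqj]]]]|].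
- by left.
- right; split=> //; exists i; split=> // j lt_ij.
  by apply/eqP; have := eqj j; rewrite lt_ij.
- case=> [lt12|[eq12 [i [lti eqj]]]]; [by left | right].
  rewrite eq12 eqxx; apply/existsP; exists i; rewrite lti; apply/forallP => j.
  by apply/implyP => /eqj->.
Qed.

Lemma drl_lt_deg m1 m2 : drl_lt m1 m2 -> (mdeg m1 <= mdeg m2)%N.
Proof. by case/drl_ltP => [/ltnW|[-> _]]. Qed.

Lemma drl_ltxx m : drl_lt m m = false.
Proof. by apply/negP => /drl_ltP[|[_ [i []]]]; rewrite ltnn. Qed.

Lemma drl_lt_trans : transitive (@drl_lt n).
Proof.
move=> m2 m1 m3 /drl_ltP lt12 /drl_ltP lt23; apply/drl_ltP.
case: lt12 lt23 => [lt12|[eq12 [i [lti eqi]]]] [lt23|[eq23 [j [ltj eqj]]]].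
- by left; apply: ltn_trans lt23.
- by left; rewrite -eq23.
- by left; rewrite eq12.
right; split; first by rewrite eq12.
have [lt_ij|lt_ji|/val_inj eq_ij] := ltngtP i j.
- exists j; rewrite (eqi j lt_ij); split=> // l lt_jl.
  by rewrite eqi ?eqj // (ltn_trans lt_ij).
- exists i; rewrite -(eqj i lt_ji); split=> // l lt_il.
  by rewrite eqi ?eqj // (ltn_trans lt_ji).
- exists i; split; first by rewrite (ltn_trans _ lti) // eq_ij.
  by move=> l lt_il; rewrite eqi // eqj // -eq_ij.
Qed.

Lemma drl_total m1 m2 : m1 != m2 -> drl_lt m1 m2 || drl_lt m2 m1.
Proof.
move=> ne; have [i0 ne0] : exists i, m1 i != m2 i.
  apply/existsP; apply: contra_neqT ne; rewrite negb_exists => /forallP eq12.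
  by apply/mnmP => i; apply/eqP; have := eq12 i; rewrite negbK.
have [lt12|lt21|eq12] := ltngtP (mdeg m1) (mdeg m2).
- by apply/orP; left; apply/drl_ltP; left.
- by apply/orP; right; apply/drl_ltP; left.
case: (@arg_maxnP _ i0 (fun i => m1 i != m2 i) (fun i => i : nat) ne0) => i nei maxi.
have eqj (j : 'I_n) : (i < j)%N -> m1 j = m2 j.
  by move=> lt_ij; apply/eqP; apply: contraTT lt_ij => /maxi; rewrite -leqNgt.
move: nei; rewrite neq_ltn => /orP[lti|lti]; apply/orP; [right|left]; apply/drl_ltP; right.
  by split=> //; exists i; split=> // j /eqj.
by split=> //; exists i; split.
Qed.

Lemma drl_lt_add2r m m1 m2 : drl_lt m1 m2 -> drl_lt (m1 + m)%MM (m2 + m)%MM.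
Proof.
move=> /drl_ltP lt12; apply/drl_ltP; rewrite !mdegD ltn_add2r.
case: lt12 => [|[-> [i [lti eqi]]]]; [by left | right; split=> //].
exists i; rewrite !mnmDE ltn_add2r; split=> // j /eqi eqj.
by rewrite !mnmDE eqj.
Qed.

(** Smaller monomials do not have larger degree, and there are finitely many
    monomials of bounded degree, so the order is well-founded. *)
Lemma drl_ind (P : 'X_{1..n} -> Prop) :
  (forall m, (forall m', drl_lt m' m -> P m') -> P m) -> forall m, P m.
Proof.
move=> IH m; pose d := (mdeg m).+1; pose rk m := #|[pred b : 'X_{1..n < d} | drl_lt b m]|.
suff H N m' : (rk m' < N)%N -> (mdeg m' < d)%N -> P m' by apply: (H (rk m).+1); rewrite ?leqnn.
elim: N m' => // N IHN m'; rewrite ltnS => rkN deg_m'; apply: IH => m'' lt_m''.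
have deg_m'' : (mdeg m'' < d)%N by apply: leq_ltn_trans deg_m'; apply: drl_lt_deg.
apply: IHN => //; apply: leq_trans rkN; apply: proper_card; apply/properP; split.
  by apply/subsetP => b; rewrite !inE => lt_b; apply: drl_lt_trans lt_b lt_m''.
by exists (BMultinom deg_m''); rewrite !inE //= drl_ltxx.
Qed.

End DegRevLex.

Section LeadingMonomial.
Variables (n : nat) (k : fieldType).
Implicit Types (p q : {mpoly k[n]}) (m t : 'X_{1..n}) (S I : {mpoly k[n]} -> Prop).

Lemma drl_max_seq (s : seq 'X_{1..n}) :
  let M := \big[(fun m1 m2 => if drl_lt m1 m2 then m2 else m1)/0%MM]_(m <- s) m in
  (s != [::] -> M \in s) /\ forall m, m \in s -> m = M \/ drl_lt m M.
Proof.
elim: s => [|a s [IHmem IHmax]] /=; first by split.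
rewrite big_cons; set M := \big[_/_]_(m <- s) m in IHmem IHmax *; split=> [_|m].
  case: ifP => lt_aM; last by rewrite mem_head.
  rewrite inE IHmem ?orbT //; apply: contraTneq lt_aM => s0.
  rewrite /M s0 big_nil; apply/negP => /drl_ltP[|[]]; rewrite mdeg0 //.
  by move/eqP; rewrite mdeg_eq0 => /eqP-> [i []]; rewrite ltnn.
rewrite inE => /orP[/eqP->|/IHmax ms]; first by case: ifP => lt_aM; [right | left].
case: ifP => // /negbT Nlt; have [->|ne] := eqVneq a M; first exact: ms.
have := drl_total ne; rewrite (negbTE Nlt) /= => lt_Ma.
by right; case: ms => [->|/drl_lt_trans]; last exact.
Qed.

Lemma lm_msupp p : p != 0 -> lm p \in msupp p.
Proof. by rewrite -msupp_eq0; apply: (drl_max_seq (msupp p)).1. Qed.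

Lemma msupp_drl_le_lm p m : m \in msupp p -> m = lm p \/ drl_lt m (lm p).
Proof. exact: (drl_max_seq (msupp p)).2. Qed.

Lemma lm_unique p t : t \in msupp p ->
  (forall m, m \in msupp p -> m = t \/ drl_lt m t) -> lm p = t.
Proof.
move=> tp tmax; have p0 : p != 0 by apply: contraTneq tp => ->; rewrite msupp0.
case: (tmax _ (lm_msupp p0)) => // lt; case: (msupp_drl_le_lm tp) => // gt.
by have := drl_lt_trans lt gt; rewrite drl_ltxx.
Qed.

Lemma lmX t : lm ('X_[t] : {mpoly k[n]}) = t.
Proof.
apply: lm_unique; first by rewrite msuppX mem_head.
by move=> m; rewrite msuppX inE => /eqP->; left.
Qed.

Lemma mem_msuppMX p t m :
  (m \in msupp (p * 'X_[t])) = (t <= m)%MM && ((m - t)%MM \in msupp p).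
Proof.
rewrite (perm_mem (msuppMX p t)); apply/mapP/andP => [[m' m'p ->]|[le_tm mtp]].
  by rewrite lem_addr addmC addmK.
by exists (m - t)%MM => //; rewrite addmC submK.
Qed.

Lemma lmMX p t : p != 0 -> lm (p * 'X_[t]) = (lm p + t)%MM.
Proof.
move=> p0; apply: lm_unique; first by rewrite mem_msuppMX lem_addl addmK lm_msupp.
move=> m; rewrite mem_msuppMX => /andP[le_tm /msupp_drl_le_lm[<-|lt]].
  by left; rewrite submK.
by right; rewrite -(submK le_tm); apply: drl_lt_add2r.
Qed.

Lemma lm_pihomog p : p != 0 -> lm (pihomog mdeg (mdeg (lm p)) p) = lm p.
Proof.
have mem m d : (m \in msupp (pihomog mdeg d p)) = (mdeg m == d) && (m \in msupp p).
  by rewrite !mcoeff_msupp mcoeff_pihomog; case: ifP; rewrite // eqxx.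
move=> p0; apply: lm_unique; first by rewrite mem eqxx lm_msupp.
by move=> m; rewrite mem => /andP[_]; apply: msupp_drl_le_lm.
Qed.

(** A leading ideal is a monomial ideal, so membership is decided on the
    monomials occurring. *)
Lemma lead_idealP S p : lead_ideal S p <->
  forall t, t \in msupp p -> exists q, [/\ S q, q != 0 & (lm q <= t)%MM].
Proof.
pose L p := forall t, t \in msupp p -> exists q, [/\ S q, q != 0 & (lm q <= t)%MM].
split=> [|Lp].
  apply: (@ideal_gen_min _ _ L) => {p}[|p [q [Sq q0 ->]] t].
    split=> [t|u v Lu Lv t|a u Lu t]; first by rewrite msupp0.
      by move/msuppD_le; rewrite mem_cat => /orP[/Lu|/Lv].
    move/msuppM_le/allpairsP => [[t1 t2] [_ /= /Lu[q [Sq q0 le]] ->]].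
    by exists q; split=> //; apply: lepm_trans le (lem_addl _ _).
  by rewrite msuppX inE => /eqP->; exists q; split=> //; apply: lepm_refl.
rewrite [p]mpolyE; have hL : is_ideal (lead_ideal S) by apply: ideal_gen_ideal.
apply: ideal_sum_seq => // t /Lp[q [Sq q0 le]].
rewrite -mul_mpolyC -(submK le) mpolyXD mulrA; case: hL => _ _; apply.
by apply: mem_ideal_gen; exists q.
Qed.

(** Division: a Groebner basis generates the ideal, because the leading term
    of an element of the ideal can be cancelled by a multiple of a basis
    element. *)
Lemma groebner_basis_gen (G : seq {mpoly k[n]}) I f :
  is_ideal I -> groebner_basis G I -> I f -> ideal_gen (fun g => g \in G) f.
Proof.
move=> hI [GI Glead]; have [G0 GD GM] := ideal_gen_ideal (fun g => g \in G).
move: {2}(lm f) (erefl (lm f)) => t; elim/drl_ind: t f => t IH f lmf If.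
have [->|f0] := eqVneq f 0; first exact: G0.
have /lead_idealP/(_ t)[] : lead_ideal (fun g => g \in G) 'X_[t].
- apply/Glead/lead_idealP => t'; rewrite msuppX inE => /eqP->.
  by exists f; split; rewrite ?lmf ?lepm_refl.
- by rewrite msuppX mem_head.
move=> g [Gg g0 le_gt].
pose h := (f@_t / g@_(lm g)) *: (g * 'X_[t - lm g]).
have glm0 : g@_(lm g) != 0 by rewrite -mcoeff_msupp lm_msupp.
have ht : h@_t = f@_t.
  have := mcoeffMX g (t - lm g) (lm g); rewrite submK // => eq_t.
  by rewrite mcoeffZ eq_t divfK.
have hG : ideal_gen (fun g => g \in G) h.
  by rewrite /h -mul_mpolyC; apply: (GM); rewrite mulrC; apply: (GM); apply: mem_ideal_gen.
have hIh : I h.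
  by rewrite /h -mul_mpolyC; case: (hI) => _ _ IM; apply: (IM); rewrite mulrC; apply: (IM); apply: GI.
rewrite -[f](subrK h); apply: (GD) => //.
have [->|fh0] := eqVneq (f - h) 0; first exact: G0.
apply: (IH (lm (f - h))) => //; last exact: idealB.
have /msuppB_le := lm_msupp fh0; rewrite mem_cat.
have Nt : lm (f - h) != t.
  by apply: contraTneq (lm_msupp fh0) => ->; rewrite mcoeff_msupp mcoeffB ht subrr eqxx.
case/orP => [/msupp_drl_le_lm|/msuppZ_le/msupp_drl_le_lm].
  by rewrite lmf => -[e|//]; rewrite e eqxx in Nt.
rewrite lmMX // addmC submK // => -[e|//].
by rewrite e eqxx in Nt.
Qed.

End LeadingMonomial.

(** * Pommaret bases *)

Lemma seq_choice (T U : eqType) (f : T -> U) (P : T -> Prop) (s : seq U) :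
  (forall u, u \in s -> exists2 x, P x & f x = u) ->
  exists2 l : seq T, [seq f x | x <- l] = s & forall x, x \in l -> P x.
Proof.
elim: s => [|u s IH] sP; first by exists [::].
have [|l eq_l lP] := IH; first by move=> v vs; apply: sP; rewrite inE vs orbT.
have [x Px fx] := sP u (mem_head _ _).
exists (x :: l); rewrite /= ?eq_l ?fx // => y.
by rewrite inE => /orP[/eqP->|/lP].
Qed.

Section Classes.
Variable n : nat.
Implicit Types (h s t : 'X_{1..n}).

Lemma mclass_geq h (i : 'I_n) : (0 < h i)%N -> (i <= mclass h)%N.
Proof. by move=> hi; rewrite /mclass (bigD1 i) //= leq_maxl. Qed.

Lemma mclass_le_of_lem h t : (h <= t)%MM -> (mclass h <= mclass t)%N.
Proof.
move=> /mnm_lepP le; apply/bigmax_leqP => i hi.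
by apply: mclass_geq; apply: leq_trans (le i).
Qed.

Lemma mclass_witness s : s != 0%MM -> exists i : 'I_n, mclass s = i /\ (0 < s i)%N.
Proof.
move=> s0; have [i0 si0] : exists i, (0 < s i)%N.
  apply/existsP; apply: contraNT s0; rewrite negb_exists => /forallP s0.
  by apply/eqP/mnmP => i; rewrite mnm0E; have := s0 i; rewrite lt0n negbK => /eqP.
have [|i si eq_i] := @eq_bigmax_cond _ [pred i | 0 < s i]%N (fun i : 'I_n => i : nat).
  by apply/card_gt0P; exists i0.
by exists i; rewrite -eq_i.
Qed.

(** A monomial is regarded as its sorted word [x_i1 x_i2 ...] with
    [i1 <= i2 <= ...]; its class is then the index of the last letter. The
    monomial 1, whose word is empty, is left unchanged. *)
Definition drop_last s :=
  if [pick i : 'I_n | (0 < s i)%N && (mclass s == i)] is Some i then (s - U_(i))%MM else s.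

Lemma drop_lastP s : s != 0%MM ->
  exists i : 'I_n, [/\ mclass s = i, (0 < s i)%N & drop_last s = (s - U_(i))%MM].
Proof.
move=> /mclass_witness[i [cs si]]; rewrite /drop_last; case: pickP => [j|/(_ i)].
  by case/andP => sj /eqP cj; exists j.
by rewrite si cs eqxx.
Qed.

Lemma drop_lastK s (i : 'I_n) : (0 < s i)%N -> (s - U_(i) + U_(i))%MM = s.
Proof. by move=> si; rewrite submK // lep1mP -lt0n. Qed.

Lemma mdeg_drop_last s : s != 0%MM -> mdeg s = (mdeg (drop_last s)).+1.
Proof.
case/drop_lastP => i [_ si ->].
by rewrite -{1}(drop_lastK si) mdegD mdeg1 addn1.
Qed.

Lemma drop_last_le s : (drop_last s <= s)%MM.
Proof.
by rewrite /drop_last; case: pickP => [i _|_]; [apply: lem_subr | apply: lepm_refl].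
Qed.

(** Pommaret division: [h] divides [s] if [s] is in the cone of [h], that is,
    if the sorted word of [h] is a prefix of that of [s]. *)
Definition pommaret_dvd h s :=
  (h <= s)%MM /\ forall i : 'I_n, (0 < (s - h)%MM i)%N -> (mclass h <= i)%N.

Lemma pommaret_dvd_refl h : pommaret_dvd h h.
Proof. by split=> [|i]; rewrite ?lepm_refl // mnmBE subnn. Qed.

Lemma pommaret_dvd_trans h t s :
  pommaret_dvd h t -> pommaret_dvd t s -> pommaret_dvd h s.
Proof.
move=> [le_ht ht] [le_ts ts]; split; first exact: lepm_trans le_ts.
move=> i; rewrite mnmBE => lt_hs.
have [lt_ts|le_st] := ltnP (t i) (s i).
  apply: leq_trans (mclass_le_of_lem le_ht) _.
  by apply: ts; rewrite mnmBE subn_gt0.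
by apply: ht; rewrite mnmBE; apply: leq_trans lt_hs _; apply: leq_sub2r.
Qed.

Lemma drop_last_dvd s : s != 0%MM -> pommaret_dvd (drop_last s) s.
Proof.
move=> s0; have [i [cs si ds]] := drop_lastP s0; split; first exact: drop_last_le.
move=> j; rewrite ds -{1}(drop_lastK si) addmC addmK mnm1E.
case: eqVneq => // <- _; rewrite -cs; apply: mclass_le_of_lem.
exact: lem_subr.
Qed.

(** A proper prefix of a word is a prefix of the word without its last letter. *)
Lemma dvd_drop_last h s :
  pommaret_dvd h s -> h != s -> pommaret_dvd h (drop_last s).
Proof.
move=> [le_hs hs] ne; have /mnm_lepP lehs := le_hs.
have [i lti] : exists i, (h i < s i)%N.
  apply/existsP; apply: contraNT ne; rewrite negb_exists => /forallP ge.
  by apply/eqP/mnmP => i; apply/eqP; rewrite eqn_leq lehs leqNgt ge.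
have s0 : s != 0%MM by apply: contraTneq lti => ->; rewrite mnm0E ltn0.
have [c [cs sc ds]] := drop_lastP s0.
have ltc : (h c < s c)%N.
  rewrite ltnNge; apply/negP => ge; have le_ic : (i <= c)%N.
    by rewrite -cs; apply: mclass_geq; apply: leq_ltn_trans lti.
  have le_ci : (c <= i)%N.
    apply: leq_trans (mclass_geq (leq_trans sc ge)) _.
    by apply: hs; rewrite mnmBE subn_gt0.
  have eq_ic : i = c by apply/val_inj/eqP; rewrite eqn_leq le_ic.
  by move: lti; rewrite eq_ic ltnNge ge.
split.
  apply/mnm_lepP => j; rewrite ds mnmBE mnm1E; case: eqVneq => [<-|_].
    by rewrite subn1 -ltnS prednK.
  by rewrite subn0.
move=> j; rewrite ds !mnmBE subnAC => lt; apply: hs; rewrite mnmBE.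
exact: leq_trans lt (leq_subr _ _).
Qed.

(** The Pommaret divisors of a monomial are the prefixes of its sorted word, so
    the shorter of two of them divides the longer. *)
Lemma pommaret_dvd_chain h h' s : pommaret_dvd h s -> pommaret_dvd h' s ->
  (mdeg h <= mdeg h')%N -> pommaret_dvd h h'.
Proof.
move: {2}(mdeg s) (leqnn (mdeg s)) => N; elim: N s => [|N IH] s le_sN hs h's le_hh'.
  move: le_sN; rewrite leqn0 mdeg_eq0 => /eqP s0; move: hs h's; rewrite s0.
  have le0 m : pommaret_dvd m (0%MM : 'X_{1..n}) -> m = 0%MM.
    by move=> [/mnm_lepP le _]; apply/mnmP => i; apply/eqP; have := le i; rewrite mnm0E leqn0.
  by move=> /le0-> /le0->; apply: pommaret_dvd_refl.
have [->//|ne'] := eqVneq h' s.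
have mdeg_lt : (mdeg h' < mdeg s)%N.
  case: h's => le _; rewrite -(submK le) mdegD -[X in (X < _)%N]add0n ltn_add2r.
  rewrite lt0n mdeg_eq0; apply: contraNneq ne' => s0.
  by rewrite -(submK le) s0 add0m.
have s0 : s != 0%MM by apply: contraTneq mdeg_lt => ->; rewrite mdeg0 ltn0.
have ne : h != s by apply: contraTneq le_hh' => ->; rewrite -ltnNge.
apply: (IH (drop_last s)) => //; [|exact: dvd_drop_last|exact: dvd_drop_last].
by rewrite -ltnS -mdeg_drop_last.
Qed.

End Classes.

Section Cones.
Variables (n : nat) (k : fieldType).
Implicit Types (p q : {mpoly k[n]}) (h s t : 'X_{1..n}).

Lemma cone_msupp h p : cone h p -> forall s, s \in msupp p -> pommaret_dvd h s.
Proof.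
move=> [q [-> qP]] s; rewrite mem_msuppMX => /andP[le_hs mq].
by split=> // i; apply: qP.
Qed.

Lemma cone0 h : cone h (0 : {mpoly k[n]}).
Proof. by exists 0; rewrite mul0r; split=> // m; rewrite msupp0. Qed.

Lemma coneD h p q : cone h p -> cone h q -> cone h (p + q).
Proof.
move=> [u [-> uP]] [v [-> vP]]; exists (u + v); rewrite mulrDl; split=> // m.
by move/msuppD_le; rewrite mem_cat => /orP[/uP|/vP].
Qed.

Lemma coneZX h s (c : k) : pommaret_dvd h s -> cone h (c *: 'X_[s]).
Proof.
move=> [le_hs hs]; exists (c *: 'X_[s - h]); rewrite -scalerAl -mpolyXD submK //.
by split=> // m /msuppZ_le; rewrite msuppX inE => /eqP->.
Qed.

End Cones.

(** [K] is to be the generic ideal, and [r] the top degree of the quotient by it. *)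
Section PommaretBasis.
Variables (n r : nat) (k : fieldType) (K : {mpoly k[n]} -> Prop).
Hypothesis hK : homogeneous_ideal K.
Hypotheses (K_above : forall p, p \is r.+1.-homog -> K p).
Hypothesis (K_top : exists p, p \is r.-homog /\ ~ K p).
Implicit Types (p q : {mpoly k[n]}) (h s t : 'X_{1..n}).

Let idK : is_ideal K. Proof. by case: hK. Qed.

(** The monomials of the leading ideal of [K]. *)
Definition lead_mon t := exists q, [/\ K q, q != 0 & (lm q <= t)%MM].

Lemma lead_monX t : lead_mon t <-> lead_ideal K 'X_[t].
Proof.
rewrite lead_idealP; split=> [lt t'|]; last by apply; rewrite msuppX mem_head.
by rewrite msuppX inE => /eqP->.
Qed.

Lemma lead_mon_up t s : lead_mon t -> (t <= s)%MM -> lead_mon s.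
Proof. by move=> [q [Kq q0 le]] le'; exists q; split=> //; apply: lepm_trans le'. Qed.

Lemma lead_mon_homog t : lead_mon t ->
  exists q, [/\ K q, q != 0, q \is (mdeg t).-homog & lm q = t].
Proof.
move=> [q [Kq q0 le]]; pose u := q * 'X_[t - lm q].
have lmu : lm u = t by rewrite lmMX // addmC submK.
have X0 : 'X_[t - lm q] != 0 :> {mpoly k[n]} by rewrite -msize_poly_eq0 msizeX.
have u0 : u != 0 by rewrite mulf_neq0.
have lmv : lm (pihomog mdeg (mdeg t) u) = t by rewrite -{1}lmu lm_pihomog.
have Ku : K u by apply: idealMr.
exists (pihomog mdeg (mdeg t) u); split=> //; last exact: pihomogP.
  by case: hK => _; apply.
apply/eqP => /(congr1 (mcoeff t)); rewrite mcoeff_pihomog eqxx mcoeff0 => /eqP.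
by rewrite -[in u@__]lmu mcoeff_eq0 lm_msupp.
Qed.

Lemma lead_mon_above t : (r < mdeg t)%N -> lead_mon t.
Proof.
move=> lt_r; exists 'X_[t]; split; last by rewrite lmX lepm_refl.
  have [m1 [m2 [-> deg1]]] := mnm_split lt_r; rewrite mpolyXD.
  by apply: idealMr => //; apply: K_above; rewrite dhomogX; apply/eqP.
by rewrite -msize_poly_eq0 msizeX.
Qed.

(** If every monomial of degree [r] were a leading one, then successive
    reduction would put all of them into [K]. *)
Lemma lead_mon_top : exists t, mdeg t = r /\ ~ lead_mon t.
Proof.
apply: NNPP => N; have [p [hp Kp]] := K_top; apply: Kp.
apply: homog_in_ideal hp => // t; elim/drl_ind: t => t IH deg_t.
have /lead_mon_homog[q [Kq q0 hq lmq]] : lead_mon t.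
  by apply: NNPP => Nt; apply: N; exists t.
have qt0 : q@_t != 0 by rewrite -mcoeff_msupp -lmq lm_msupp.
have Kt : K (q@_t *: 'X_[t]).
  have -> : q@_t *: 'X_[t] = q - \sum_(m <- msupp q | m != t) q@_m *: 'X_[m].
    by rewrite {2}[q]mpolyE (bigD1_seq t) ?msupp_uniq //= ?mcoeff_msupp // addrK.
  apply: idealB => //; rewrite big_seq_cond; apply: ideal_sum => // m /andP[mq ne].
  rewrite -mul_mpolyC; case: idK => _ _; apply; apply: IH.
    by have [|] := msupp_drl_le_lm mq; rewrite lmq // => e; rewrite e eqxx in ne.
  by rewrite -deg_t; apply: (dhomogP _ _ _ hq).
rewrite -['X_[t]]scale1r -(mulVf qt0) -scalerA -mul_mpolyC.
by case: idK => _ _; apply.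
Qed.

Lemma lead_mon0 : ~ lead_mon 0%MM.
Proof.
have [t [_ Nt]] := lead_mon_top => l0; apply: Nt; apply: lead_mon_up l0 _.
by apply/mnm_lepP => i; rewrite mnm0E.
Qed.

(* The longest proper prefix suffices: if it is not a leading monomial, no
   shorter prefix is. *)
Let minimal h := lead_mon h /\ ~ lead_mon (drop_last h).

Let lead_mon_neq0 h : lead_mon h -> h != 0%MM.
Proof. by move=> lh; apply/eqP => h0; apply: lead_mon0; rewrite -h0. Qed.

Let minimal_cover s : lead_mon s -> exists h, minimal h /\ pommaret_dvd h s.
Proof.
move: {2}(mdeg s) (leqnn (mdeg s)) => N; elim: N s => [|N IH] s le_sN ls.
  by have := lead_mon_neq0 ls; rewrite -mdeg_eq0 -leqn0 le_sN.
have s0 := lead_mon_neq0 ls.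
have [ld|Nld] := classic (lead_mon (drop_last s)); last first.
  by exists s; split; [split | apply: pommaret_dvd_refl].
have [|h [mh hd]] := IH _ _ ld; first by rewrite -ltnS -mdeg_drop_last.
exists h; split=> //; apply: pommaret_dvd_trans hd _; exact: drop_last_dvd.
Qed.

Let minimal_unique h h' s : minimal h -> minimal h' ->
  pommaret_dvd h s -> pommaret_dvd h' s -> h = h'.
Proof.
wlog le : h h' / (mdeg h <= mdeg h')%N.
  move=> H mh mh' hs h's; have [le|/ltnW le] := leqP (mdeg h) (mdeg h').
    exact: H le mh mh' hs h's.
  by apply/esym; apply: H le mh' mh h's hs.
move=> [lh _] [_ Nlh'] hs h's; apply/eqP/negPn/negP => ne; apply: Nlh'.
have [] := dvd_drop_last (pommaret_dvd_chain hs h's le) ne.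
by move=> le' _; apply: lead_mon_up lh le'.
Qed.

(** The minimal prefixes of leading monomials form a Pommaret basis of the
    leading ideal, since each leading monomial has exactly one; they are finite
    in number since their degree is at most [r + 1]. *)
Lemma pommaret_basis_exists : exists H, pommaret_basis H K.
Proof.
have minimal_deg h : minimal h -> (mdeg h < r.+2)%N.
  move=> [lh Nd]; rewrite mdeg_drop_last ?lead_mon_neq0 // !ltnS leqNgt.
  by apply/negP => /lead_mon_above.
pose Hm := [seq m <- [seq bmnm b | b <- enum {: 'X_{1..n < r.+2}}] | boolp.asbool (minimal m)].
have uHm : uniq Hm by rewrite filter_uniq // map_inj_uniq ?enum_uniq //; apply: val_inj.
have HmP h : h \in Hm <-> minimal h.
  rewrite mem_filter; split=> [/andP[/boolp.asboolP]//|mh].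
  apply/andP; split; first exact/boolp.asboolP.
  by apply/mapP; exists (BMultinom (minimal_deg h mh)); rewrite ?mem_enum.
have [|H mapH HP] := @seq_choice _ _ (@lm n k)
    (fun q => [/\ K q, q != 0 & exists d, q \is d.-homog]) Hm.
  move=> h /HmP[/lead_mon_homog[q [Kq q0 hq lmq]] _]; exists q => //.
  by split=> //; exists (mdeg h).
exists H; split=> //; first by rewrite mapH.
rewrite mapH; split=> //.
- by move=> h /HmP[lh _]; apply/lead_monX.
- move=> p; have idL : is_ideal (lead_ideal K) by apply: ideal_gen_ideal.
  split=> [/lead_idealP Lp|[c [cP ->]]]; last first.
    apply: ideal_sum_seq => // h hH; have [q [-> _]] := cP h hH.
    by case: idL => _ _; apply; apply/lead_monX; have [] := (HmP h).1 hH.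
  pose dvdb h s := boolp.asbool (pommaret_dvd h s).
  have dvdP h s : reflect (pommaret_dvd h s) (dvdb h s) by apply: boolp.asboolP.
  exists (fun h => \sum_(s <- msupp p | dvdb h s) p@_s *: 'X_[s]); split.
    move=> h _; apply: big_ind => [|u v|s /dvdP]; [exact: cone0|exact: coneD|exact: coneZX].
  rewrite (exchange_big_dep predT) //= {1}[p]mpolyE; rewrite big_seq [RHS]big_seq.
  apply: eq_bigr => s /Lp/minimal_cover[h [mh hs]].
  rewrite (big_rem h) /=; last exact/HmP.
  have/dvdP-> := hs; rewrite big_seq_cond big1 ?addr0 // => h'.
  rewrite mem_rem_uniq // !inE => /andP[/andP[ne /HmP mh'] /dvdP h's].
  by rewrite (minimal_unique mh' mh h's hs) eqxx in ne.
- move=> c cP sum0 h hH; apply/eqP/negPn/negP => ch0.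
  have sh := lm_msupp ch0; have hs := cone_msupp (cP h hH) sh.
  move: sh; rewrite mcoeff_msupp; case/negP.
  move/(congr1 (mcoeff (lm (c h)))): sum0; rewrite raddf_sum mcoeff0 (bigD1_seq h) //=.
  rewrite big_seq_cond big1 ?addr0 => [->//|h' /andP[h'H ne]].
  apply: memN_msupp_eq0; apply/negP => /(cone_msupp (cP h' h'H)) h's.
  by rewrite (minimal_unique ((HmP h').1 h'H) ((HmP h).1 hH) h's hs) eqxx in ne.
Qed.

Section Degree.
Variables (H : seq {mpoly k[n]}) (bH : pommaret_basis H K).

Let Hm := [seq lm q | q <- H].

Let basis_lead h : h \in Hm -> lead_mon h.
Proof. by case: bH => _ _ [_ HL _ _] /HL; rewrite lead_monX. Qed.

Let basis_cover s : lead_mon s -> exists2 h, h \in Hm & pommaret_dvd h s.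
Proof.
move=> /lead_monX; case: bH => _ _ [_ _ Hgen _] /Hgen[c [cP eq_s]].
have : (\sum_(h <- Hm) c h)@_s != 0 by rewrite -eq_s mcoeffX eqxx oner_eq0.
rewrite raddf_sum /= => sum0; apply: NNPP => N; case/eqP: sum0.
rewrite big_seq big1 // => h hH; apply: memN_msupp_eq0; apply/negP => sh.
by apply: N; exists h => //; apply: cone_msupp sh; apply: cP.
Qed.

(* If two cones shared [s], then ['X_[s] - 'X_[s] = 0] would contradict the
   directness of the sum. *)
Let basis_unique h h' s : h \in Hm -> h' \in Hm ->
  pommaret_dvd h s -> pommaret_dvd h' s -> h = h'.
Proof.
move=> hH h'H hs h's; apply/eqP/negPn/negP => ne.
case: bH => _ _ [uHm _ _ Hdir].
have sum1 g : g \in Hm -> \sum_(u <- Hm) (u == g)%:R = 1 :> k.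
  move=> gH; rewrite (bigD1_seq g) //= eqxx big1 ?addr0 // => u /negbTE->.
  by [].
pose c (g : 'X_{1..n}) : {mpoly k[n]} := ((g == h)%:R - (g == h')%:R) *: 'X_[s].
have cP g : g \in Hm -> cone g (c g).
  move=> _; rewrite /c; case: eqVneq => [->|_]; first exact: coneZX.
  case: eqVneq => [->|_]; first exact: coneZX.
  by rewrite subrr scale0r; apply: cone0.
have := Hdir c cP; rewrite -scaler_suml sumrB !sum1 // subrr scale0r.
move=> /(_ erefl h hH)/(congr1 (mcoeff s)).
rewrite /c eqxx (negbTE ne) subr0 scale1r mcoeffX eqxx mcoeff0 => /eqP.
by rewrite oner_eq0.
Qed.

Let basis_homog q : q \in H -> (msize q).-1 = mdeg (lm q).
Proof.
case: bH => Hq _ _ /Hq[_ q0 [d hq]].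
by rewrite (msizeS_homog hq q0) /= (dhomog_mf hq (lm_msupp q0)).
Qed.

(* Beyond degree [r + 1] the word without its last letter is still in the
   leading ideal, so a shorter basis element is a prefix of it. *)
Let basis_deg_le h : h \in Hm -> (mdeg h <= r.+1)%N.
Proof.
move=> hH; rewrite leqNgt; apply/negP => lt_rh.
have h0 : h != 0%MM by apply: contraTneq lt_rh => ->; rewrite mdeg0.
have ld : lead_mon (drop_last h) by apply: lead_mon_above; rewrite -ltnS -mdeg_drop_last.
have [g gH gd] := basis_cover ld.
have eq_gh : g = h.
  apply: (basis_unique gH hH) (pommaret_dvd_refl h).
  exact: pommaret_dvd_trans gd (drop_last_dvd h0).
have [le _] := gd; have := mdeg_drop_last h0; rewrite -{1}eq_gh => eq_deg.
by have := mdegB (drop_last h) (drop_last h - g); rewrite -(submK le) mdegD in eq_deg *; lia.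
Qed.

Let le_basis_degree h : h \in Hm -> (mdeg h <= basis_degree H)%N.
Proof.
case/mapP => q qH ->; rewrite -basis_homog // /basis_degree.
by rewrite (big_rem q) //= leq_maxl.
Qed.

Lemma basis_degree_gt0 : H <> [::] -> (0 < basis_degree H)%N.
Proof.
case eH : H => [//|q H'] _; have qH : q \in H by rewrite eH mem_head.
have lH : lm q \in Hm by apply: map_f.
rewrite -eH; apply: leq_trans (le_basis_degree lH).
by rewrite lt0n mdeg_eq0; apply/lead_mon_neq0/basis_lead.
Qed.

(** The degree [r + 1] is attained: multiplying a monomial of degree [r] that
    is not a leading one by the last variable gives a leading monomial all of
    whose proper prefixes are not leading monomials. *)
Lemma basis_degree_pred : (basis_degree H).-1 = r.
Proof.
have le_deg : (basis_degree H <= r.+1)%N.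
  rewrite /basis_degree big_seq; apply: (big_ind (fun N => N <= r.+1)%N) => //.
    by move=> a b ha hb; rewrite geq_max ha.
  by move=> q qH; rewrite basis_homog //; apply: basis_deg_le; apply: map_f.
have [t [deg_t Nt]] := lead_mon_top.
have [n0|n_gt0] := posnP n.
  have all0 (m : 'X_{1..n}) : m = 0%MM.
    by apply/mnmP => i; exfalso; case: i => i; rewrite n0.
  have r0 : r = 0%N by rewrite -deg_t (all0 t) mdeg0.
  case eH : H => [|q H']; first by rewrite /basis_degree big_nil r0.
  have lH : lm q \in Hm by apply: map_f; rewrite eH mem_head.
  by case: lead_mon0; rewrite -(all0 (lm q)); apply: basis_lead.
have lt_max : (n.-1 < n)%N by rewrite prednK.
pose last := Ordinal lt_max; pose s := (t + U_(last))%MM.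
have ls : lead_mon s by apply: lead_mon_above; rewrite mdegD mdeg1 deg_t addn1.
have s0 := lead_mon_neq0 ls.
have ds : drop_last s = t.
  have [i [cs si ->]] := drop_lastP s0; suff -> : i = last by rewrite addmK.
  apply/val_inj/eqP; rewrite eqn_leq /= -ltnS prednK // ltn_ord -cs /=.
  by apply: (@mclass_geq _ s last); rewrite mnmDE mnm1E eqxx addn1.
have [h hH hs] := basis_cover ls.
have eq_h : h = s.
  apply/eqP/negPn/negP => ne; apply: Nt; have [le _] := dvd_drop_last hs ne.
  by rewrite -ds; apply: lead_mon_up (basis_lead hH) le.
have := le_basis_degree hH; rewrite eq_h mdegD mdeg1 deg_t addn1 => ge_deg.
by have/eqP-> : basis_degree H == r.+1 by rewrite eqn_leq le_deg.
Qed.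

End Degree.
End PommaretBasis.

(** * The reduction number *)

(** A proper homogeneous ideal has no element with a constant term, and the
    substitution by linear forms preserves this. *)
Lemma elim_image_proper e D (k F : fieldType) (I : {mpoly k[e + D]} -> Prop)
    (iota : {rmorphism k -> F}) (A : 'M[F]_(D, e)) :
  homogeneous_ideal I -> is_proper I -> is_proper (elim_image I iota A).
Proof.
move=> [[I0 ID IM] Ihom] I1 im1.
have : (1 : {mpoly F[e]})@_0 = 0.
  apply: (@ideal_gen_min _ _ (fun p => p@_0 = 0) _ _ _ im1) => [|p [g Ig ->]].
    split=> [|u v u0 v0|a u u0]; first exact: mcoeff0.
      by rewrite mcoeffD u0 v0 addr0.
    by rewrite rmorphM /= u0 mulr0.
  have g0 : pihomog mdeg 0 g = 0.
    have := Ihom g 0%N Ig; have := pihomogP mdeg 0 g; move: (pihomog _ _ _) => h hh Ih.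
    have [//|h0] := eqVneq h 0; case: I1.
    have eq_h : h = (h@_0)%:MP by apply: msize1_polyC; rewrite (msizeS_homog hh h0).
    have c0 : h@_0 != 0 by rewrite -(mpolyC_eq0 (e + D)) -eq_h.
    by rewrite -mpolyC1 -(mulVf c0) mpolyCM -eq_h; apply: IM.
  have -> : (map_mpoly iota g \mPo elim_forms A)@_0 =
      (pihomog mdeg 0 (map_mpoly iota g \mPo elim_forms A))@_0.
    by rewrite mcoeff_pihomog mdeg0.
  rewrite pihomog_comp_linear; last exact: elim_forms_linear.
  by rewrite map_mpoly_pihomog g0 raddf0 comp_mpoly0 mcoeff0.
by rewrite mcoeff1 eqxx => /eqP; rewrite oner_eq0.
Qed.

Section GenericReduction.
Variables (k : fieldType) (e D : nat) (I : {mpoly k[e + D]} -> Prop).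
Hypotheses (hk : infinite_type k) (hI : homogeneous_ideal I) (hI1 : is_proper I).
Hypothesis hD : krull_dim I D.
Variable G : seq {mpoly k[e + D]}.
Hypothesis hG : groebner_basis G I.

Local Notation image := (@generic_ideal k (e + D) e D G).

Let idI : is_ideal I. Proof. by case: hI. Qed.

(** A Groebner basis generates the ideal, so any Groebner basis gives the same
    generic ideal as all of [I]. *)
Lemma generic_idealE p :
  image p <-> elim_image I (to_param e D k) (param_mx e D k) p.
Proof.
split; apply: ideal_gen_mono => {}p [g Ig ->].
  apply: mem_ideal_gen; exists g; last exact: generic_substE.
  by case: hG => + _; apply.
have := elim_ideal_gen (to_param e D k) (param_mx e D k) (groebner_basis_gen idI hG Ig).
apply: ideal_gen_mono => q [u Gu eq_q].
have eq_q' : q = generic_subst e D u by rewrite eq_q generic_substE.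
by apply: mem_ideal_gen; exists u.
Qed.

Lemma generic_ideal_homogeneous : homogeneous_ideal image.
Proof.
split=> [|p d /generic_idealE imp]; first exact: ideal_gen_ideal.
by apply/generic_idealE/elim_image_homogeneous.
Qed.

Lemma generic_ideal_proper : is_proper image.
Proof. by move=> /generic_idealE; apply: elim_image_proper. Qed.

(** This and its converse below express the generic ideal through choices of [D]
    linear forms over [k]. *)
Lemma covers_generic_ideal d (y : D.-tuple {mpoly k[e + D]}) :
  linear_forms y -> covers I y d ->
  forall p, p \is d.-homog -> image p.
Proof.
move=> liny cov p hp; apply/generic_idealE.
have [A covA] := covers_normal_form hk hI (covers_coefs liny cov).
have := covers_generic hI covA; rewrite param_formsE => covK.
exact: (covers_elim_image I (to_param e D k) (param_mx e D k) d).1 covK p hp.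
Qed.

Lemma generic_ideal_covers d : (forall p, p \is d.-homog -> image p) ->
  exists y : D.-tuple {mpoly k[e + D]}, linear_forms y /\ covers I y d.
Proof.
move=> im; have [|A cov] := @covers_specialize e D d k I hk hI.
  rewrite param_formsE.
  apply: (covers_elim_image I (to_param e D k) (param_mx e D k) d).2 => p hp.
  exact: (generic_idealE p).1 (im p hp).
exists [tuple lin_form (row_mx A 1%:M) i | i < D]; split; last exact: covers_lin_forms.
by move=> i; rewrite tnth_mktuple; apply: lin_form_homog.
Qed.

(** The least degree that is full exists because some forms over [k] cover a
    degree, and it is positive because the generic ideal is proper. *)
Lemma generic_top_degree : exists r,
  (forall p, p \is r.+1.-homog -> image p) /\ exists p, p \is r.-homog /\ ~ image p.
Proof.
pose full d := forall p, p \is d.-homog -> image p.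
have [d0 full0] : exists d, boolp.asbool (full d).
  have [y [liny [d cov]]] := covered_by_dim hk hI hI1 hD.
  by exists d; apply/boolp.asboolP; apply: covers_generic_ideal cov.
case: (ex_minnP (ex_intro (fun d => boolp.asbool (full d)) d0 full0)) => q /boolp.asboolP fullq qmin.
case: q fullq qmin => [full_0|r fullr qmin].
  by case: generic_ideal_proper; apply: full_0; apply: dhomog1.
exists r; split=> //; apply: NNPP => N.
suff : (r < r)%N by rewrite ltnn.
apply: qmin; apply/boolp.asboolP => p hp; apply: NNPP => Np.
by apply: N; exists p.
Qed.

(** Degree [r + 1] of the generic ideal specialises to a Noether normalisation
    with reduction number [r]; conversely, a Noether normalisation with
    reduction number [s < r] would make the generic ideal full in degree [r]. *)
Lemma generic_reduction_number r :
  (forall p, p \is r.+1.-homog -> image p) ->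
  (exists p, p \is r.-homog /\ ~ image p) -> reduction_number I D r.
Proof.
move=> full [p0 [hp0 Np0]]; split=> [|y s [liny _ _] [_ smax]].
  have [y [liny cov]] := generic_ideal_covers full; exists y; split.
    exact: covering_noether_normalisation liny cov.
  split=> [|d p hp Np].
    apply: NNPP => N; apply: Np0; apply: covers_generic_ideal hp0; first exact: liny.
    by move=> p hp; apply: NNPP => Np; apply: N; exists p.
  by rewrite leqNgt; apply/negP => lt_rd; apply: Np; apply: coversS cov _ hp.
rewrite leqNgt; apply/negP => lt_sr; apply: Np0; apply: covers_generic_ideal hp0 => //.
move=> p hp; apply: NNPP => /(smax r p hp).
by rewrite leqNgt lt_sr.
Qed.

End GenericReduction.

Theorem theorem5p6 (k : fieldType) (hk : infinite_type k) (n D : nat)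
    (I : {mpoly k[n]} -> Prop)
    (hI : homogeneous_ideal I) (hI1 : is_proper I) (hD : krull_dim I D)
    (G : seq {mpoly k[n]}) (hG : groebner_basis G I) :
  (exists H, pommaret_basis H (@generic_ideal k n (n - D)%N D G)) /\
  (forall H, pommaret_basis H (@generic_ideal k n (n - D)%N D G) ->
     reduction_number I D (basis_degree H).-1 /\
     (H <> [::] -> (0 < basis_degree H)%N)).
Proof.
have le_Dn : (D <= n)%N := dim_le_covered hI hD (covered_by_vars I).
set e := (n - D)%N; have eq_n : n = (e + D)%N by rewrite subnK.
clearbody e; subst n.
have homK := generic_ideal_homogeneous hI hG.
have [r [full top]] := generic_top_degree hk hI hI1 hD hG.
split=> [|H bH]; first exact: pommaret_basis_exists homK full top.
split; last exact (basis_degree_gt0 homK top bH).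
by rewrite (basis_degree_pred homK full top bH); apply: generic_reduction_number full top.
Qed.
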